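(* Model checking $\mathcal{L}_{\mathsf{EL}}$ on knowledge structures is PSPACE-hard. That is, the following decision problem is PSPACE-hard: given a finite set of agents $A$, a knowledge structure $\mathcal{F}=(V,\theta,O)$ whose state law $\theta$ is given as a BDD, a state $s$ of $\mathcal{F}$, and a formula $\phi\in\mathcal{L}_{\mathsf{EL}}(V)$, decide whether $\mathcal{F},s\vDash\phi$. (Input size: $|V|+|\theta|+\sum_{i\in A}|O_i|+|\phi|$, where $|\theta|$ is the number of nodes of the BDD and $|\phi|$ the length of $\phi$.)
   Context: A vocabulary $V$ is a finite, linearly ordered set of propositional atoms; $A$ is a finite set of agents. Boolean formulas over $V$: $\beta::=\top\mid\bot\mid p\mid\neg\beta\mid\beta\land\beta$ ($p\in V$). A state is a subset $s\subseteq V$ (the atoms true at it); $s\vDash\beta$ is ordinary Boolean satisfaction. Boolean functions are represented by reduced ordered binary decision diagrams (BDDs) with respect to the order of the vocabulary; the size of a BDD is its number of nodes. The language $\mathcal{L}_{\mathsf{EL}}(V)$ is given by $\phi::=\top\mid\bot\mid p\mid\neg\phi\mid\phi\land\phi\mid K_i\phi$ with $p\in V$, $i\in A$. Length: $|\top|=|\bot|=|p|=1$, $|\neg\phi|=|\phi|+1$, $|\phi_1\land\phi_2|=|\phi_1|+|\phi_2|+1$, $|K_i\phi|=|\phi|+1$. A knowledge structure is $\mathcal{F}=(V,\theta,O)$ with $\theta$ a Boolean formula (Boolean function) over $V$ (the state law) and $O_i\subseteq V$ for each $i\in A$ (observables). A state of $\mathcal{F}$ is an $s\subseteq V$ with $s\vDash\theta$.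 Semantics: $\mathcal{F},s\vDash\top$; $\mathcal{F},s\not\vDash\bot$; $\mathcal{F},s\vDash p$ iff $p\in s$; negation and conjunction as usual; $\mathcal{F},s\vDash K_i\phi$ iff for all states $t$ of $\mathcal{F}$ with $s\cap O_i=t\cap O_i$ we have $\mathcal{F},t\vDash\phi$. *)

(* Defs.v *)
From HB Require Import structures.
From mathcomp Require Import all_boot all_order.
From mathcomp Require Import zify.

Set Implicit Arguments.
Unset Strict Implicit.
Unset Printing Implicit Defensive.

(** * Deterministic multi-tape Turing machines *)

(* A tape cell holds [None] (blank), an input/output bit [Some (inl b)], or one
   of the machine's own auxiliary symbols [Some (inr x)]. *)
Definition cell (aux : Type) : Type := option (bool + aux).

Inductive dir := MoveL | Stay | MoveR.

Record machine := Machine {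
  extra_tapes : nat;  (* the machine has [extra_tapes.+1] tapes *)
  mstate : finType;
  aux_sym : finType;
  start : mstate;
  halting : pred mstate;
  accepting : pred mstate;
  delta : mstate -> {ffun 'I_extra_tapes.+1 -> cell aux_sym} ->
          mstate * ('I_extra_tapes.+1 -> cell aux_sym * dir)
}.

(* The visited part of a two-way infinite tape: [lpart] is listed from the
   head outwards; all cells outside the visited part are blank. *)
Record tape (aux : Type) := Tape {
  lpart : seq (cell aux);
  hcell : cell aux;
  rpart : seq (cell aux)
}.

Definition tape_cells aux (t : tape aux) : seq (cell aux) :=
  rev (lpart t) ++ hcell t :: rpart t.

Definition act aux (t : tape aux) (a : cell aux * dir) : tape aux :=
  let: (c, d) := a in
  match d with
  | Stay => Tape (lpart t) c (rpart t)
  | MoveL => Tape (behead (lpart t)) (head None (lpart t)) (c :: rpart t)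
  | MoveR => Tape (c :: lpart t) (head None (rpart t)) (behead (rpart t))
  end.

Definition bits aux (w : seq bool) : seq (cell aux) :=
  [seq Some (inl b) | b <- w].

Definition blank_tape aux : tape aux := Tape [::] None [::].

Definition input_tape aux (w : seq bool) : tape aux :=
  Tape [::] (head None (bits aux w)) (behead (bits aux w)).

(* The tape contains exactly [w], surrounded by blanks. *)
Definition tape_holds aux (t : tape aux) (w : seq bool) : Prop :=
  exists i j, tape_cells t = nseq i None ++ bits aux w ++ nseq j None.

Section Runs.
Variable M : machine.

Record config := Config {
  cstate : mstate M;
  ctape : {ffun 'I_(extra_tapes M).+1 -> tape (aux_sym M)}
}.

Definition init (w : seq bool) : config :=
  Config (start M)
    [ffun k => if k == ord0 then input_tape _ w else blank_tape _].

Definition step (c : config) : config :=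
  if halting (cstate c) then c else
  let: (q, a) := delta (cstate c) [ffun k => hcell (ctape c k)] in
  Config q [ffun k => act (ctape c k) (a k)].

Definition run (t : nat) (w : seq bool) : config := iter t step (init w).

Definition space (c : config) : nat := \sum_k size (tape_cells (ctape c k)).

End Runs.

(** * Complexity classes *)

Definition language := seq bool -> Prop.

Definition polynomially_bounded (T : nat -> nat) : Prop :=
  exists c d, forall n, T n <= c * n ^ d + c.

Definition PSPACE (L : language) : Prop :=
  exists (M : machine) (S : nat -> nat), polynomially_bounded S /\
  forall w : seq bool,
    (forall t, space (run M t w) <= S (size w)) /\
    exists t, halting (cstate (run M t w)) /\
              (L w <-> accepting (cstate (run M t w))).

Definition polytime_computable (f : seq bool -> seq bool) : Prop :=
  exists (M : machine) (T : nat -> nat), polynomially_bounded T /\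
  forall w : seq bool,
    exists t, [/\ t <= T (size w),
                  halting (cstate (run M t w)) &
                  tape_holds (ctape (run M t w) ord0) (f w)].

Definition polytime_reducible (L1 L2 : language) : Prop :=
  exists f, polytime_computable f /\ forall w, L1 w <-> L2 (f w).

Definition PSPACE_hard (L : language) : Prop :=
  forall L', PSPACE L' -> polytime_reducible L' L.

(** * Epistemic logic on knowledge structures *)

Inductive form (A V : Type) :=
  | Top | Bot
  | Atom of V
  | Neg of form A V
  | And of form A V & form A V
  | K of A & form A V.

Arguments Top {A V}.
Arguments Bot {A V}.
Arguments Atom {A V}.

Fixpoint flen A V (f : form A V) : nat :=
  match f with
  | Top | Bot | Atom _ => 1
  | Neg g => flen g + 1
  | And g h => flen g + flen h + 1
  | K _ g => flen g + 1
  end.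

Record kstruct (A V : finType) := KStruct {
  law : pred {set V};
  obs : A -> {set V}
}.

Fixpoint sat (A V : finType) (F : kstruct A V) (s : {set V})
    (f : form A V) : Prop :=
  match f with
  | Top => True
  | Bot => False
  | Atom p => p \in s
  | Neg g => ~ sat F s g
  | And g h => sat F s g /\ sat F s h
  | K i g => forall t : {set V}, law F t ->
               s :&: obs F i = t :&: obs F i -> sat F t g
  end.

(** * Binary decision diagrams *)

Inductive bdd_node (V N : Type) :=
  | Terminal of bool
  | Branch of V & N & N.  (* [Branch v lo hi]: [hi] is taken when [v] holds *)

Arguments Terminal {V N}.

Record bdd (V : Type) := Bdd {
  bdd_size : nat;
  label : {ffun 'I_bdd_size -> bdd_node V 'I_bdd_size};
  root : 'I_bdd_size
}.

Definition bdd_edge V (D : bdd V) : rel 'I_(bdd_size D) := fun x y =>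
  if label D x is Branch _ lo hi then (y == lo) || (y == hi) else false.

Definition ordered (d : Order.disp_t) (V : finOrderType d) (D : bdd V) : Prop :=
  forall x y v lo hi v' lo' hi',
    label D x = Branch v lo hi -> bdd_edge x y ->
    label D y = Branch v' lo' hi' -> (v < v')%O.

Definition reduced V (D : bdd V) : Prop :=
  [/\ injective (label D),
      forall x v lo hi, label D x = Branch v lo hi -> lo <> hi &
      forall x, connect (@bdd_edge V D) (root D) x].

Definition bdd_next (V : finType) (D : bdd V) (s : {set V})
    (x : 'I_(bdd_size D)) : 'I_(bdd_size D) :=
  match label D x with
  | Terminal _ => x
  | Branch v lo hi => if v \in s then hi else lo
  end.

(* In an ordered diagram no node repeats on a path, so [bdd_size D] steps from
   the root always reach a terminal. *)
Definition bdd_eval (V : finType) (D : bdd V) (s : {set V}) : bool :=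
  if label D (iter (bdd_size D) (bdd_next s) (root D)) is Terminal b
  then b else false.

(** * The model checking problem *)

(* Agents and atoms are named by [0 .. n-1]; atoms are ordered as numbers. *)
Record instance := Instance {
  nagents : nat;
  natoms : nat;
  law_bdd : bdd 'I_natoms;
  observables : {ffun 'I_nagents -> {set 'I_natoms}};
  actual : {set 'I_natoms};
  query : form 'I_nagents 'I_natoms
}.

Definition kstruct_of (I : instance) : kstruct 'I_(nagents I) 'I_(natoms I) :=
  KStruct (bdd_eval (law_bdd I)) (observables I).

Definition well_formed (I : instance) : Prop :=
  [/\ ordered (law_bdd I), reduced (law_bdd I) &
      law (kstruct_of I) (actual I)].

Definition instance_size (I : instance) : nat :=
  natoms I + bdd_size (law_bdd I) + \sum_i #|observables I i|
  + flen (query I).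

(** ** Encoding of instances as bit strings

    An instance is flattened to a sequence of numbers, each written in unary.
    Names are bounded by the numbers of atoms, agents and nodes, so unary
    costs only a polynomial factor: see [instance_size_le] and
    [size_encode_le]. *)

Definition unary (n : nat) : seq bool := rcons (nseq n true) false.

Definition code_set n (B : {set 'I_n}) : seq nat :=
  #|B| :: [seq val x | x <- enum B].

Definition code_node n m (x : bdd_node 'I_n 'I_m) : seq nat :=
  match x with
  | Terminal b => [:: nat_of_bool b]
  | Branch v lo hi => [:: 2; val v; val lo; val hi]
  end.

Definition code_bdd n (D : bdd 'I_n) : seq nat :=
  [:: bdd_size D, val (root D) &
      flatten [seq code_node (label D x) | x <- enum 'I_(bdd_size D)]].

Fixpoint code_form a n (f : form 'I_a 'I_n) : seq nat :=
  match f with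
  | Top => [:: 0]
  | Bot => [:: 1]
  | Atom p => [:: 2; val p]
  | Neg g => 3 :: code_form g
  | And g h => 4 :: code_form g ++ code_form h
  | K i g => [:: 5, val i & code_form g]
  end.

Definition code_instance (I : instance) : seq nat :=
  [:: nagents I, natoms I &
      code_bdd (law_bdd I)
      ++ flatten [seq code_set (observables I i) | i <- enum 'I_(nagents I)]
      ++ code_set (actual I)
      ++ code_form (query I)].

Definition encode (I : instance) : seq bool :=
  flatten [seq unary n | n <- code_instance I].

Definition model_checking_EL : language := fun w =>
  exists I : instance,
    [/\ encode I = w, well_formed I & sat (kstruct_of I) (actual I) (query I)].

(** ** Adequacy of the encoding *)

Lemma unary_inj m n (r r' : seq bool) :
  unary m ++ r = unary n ++ r' -> m = n /\ r = r'.
Proof.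
rewrite /unary; elim: m n => [|m IH] [|n] //=; first by case.
by case=> /IH [-> ->].
Qed.

Lemma unary_seq_inj (s s' : seq nat) :
  flatten [seq unary n | n <- s] = flatten [seq unary n | n <- s'] -> s = s'.
Proof.
have nil0 n (r : seq bool) : unary n ++ r = [::] -> False.
  by rewrite /unary; case: n.
elim: s s' => [|m s IH] [|n s'] //=.
- by move/esym/nil0.
- by move/nil0.
- by case/unary_inj => -> /IH ->.
Qed.

Lemma code_set_inj n (B B' : {set 'I_n}) r r' :
  code_set B ++ r = code_set B' ++ r' -> B = B' /\ r = r'.
Proof.
rewrite /code_set /= => -[eqc].
move/eqP; rewrite eqseq_cat ?size_map -?cardE // => /andP[/eqP eqe /eqP ->].
split=> //; apply/setP => x.
by rewrite -(mem_enum B) -(mem_enum B') (inj_map val_inj eqe).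
Qed.

Lemma code_node_inj n m (x x' : bdd_node 'I_n 'I_m) r r' :
  code_node x ++ r = code_node x' ++ r' -> x = x' /\ r = r'.
Proof.
case: x x' => [b|v l h] [b'|v' l' h'] /= => [[]|[]|[]|[]].
- by case: b b' => [] [] //= _ ->.
- by case: b.
- by case: b'.
- by move=> /val_inj -> /val_inj -> /val_inj -> ->.
Qed.

Lemma code_form_inj a n (f g : form 'I_a 'I_n) r r' :
  code_form f ++ r = code_form g ++ r' -> f = g /\ r = r'.
Proof.
elim: f g r r' => [||p|f IH|f IHf h IHh|i f IH] [||q|g|g k|j g] r r' //= [].
- by move=> ->.
- by move=> ->.
- by move=> /val_inj -> ->.
- by case/IH => -> ->.
- by rewrite -!catA => /IHf [-> /IHh [-> ->]].
- by move=> /val_inj -> /IH [-> ->].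
Qed.

Lemma flatten_code_inj (T : Type) (code : T -> seq nat)
    (codeI : forall x x' r r', code x ++ r = code x' ++ r' -> x = x' /\ r = r')
    (I : eqType) (F G : I -> T) (s : seq I) r r' :
  flatten [seq code (F i) | i <- s] ++ r = flatten [seq code (G i) | i <- s] ++ r' ->
  (forall i, i \in s -> F i = G i) /\ r = r'.
Proof.
elim: s => [|i s IH] //=; rewrite -!catA => /codeI[eqi /IH[eqs ->]].
by split=> // j; rewrite inE => /predU1P[->|/eqs].
Qed.

Lemma code_bdd_inj n (D D' : bdd 'I_n) r r' :
  code_bdd D ++ r = code_bdd D' ++ r' -> D = D' /\ r = r'.
Proof.
case: D D' => [m l rt] [m' l' rt']; rewrite /code_bdd /= => -[eqm].
subst m' => /val_inj eqr.
case/(flatten_code_inj (@code_node_inj n m)) => eql ->; rewrite eqr.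
suff -> : l = l' by [].
by apply/ffunP => x; apply: eql; rewrite mem_enum.
Qed.

Lemma encode_inj : injective encode.
Proof.
case=> [a n D O s f] [a' n' D' O' s' f'] /unary_seq_inj.
have cons2 (x y x' y' : nat) t t' :
    [:: x, y & t] = [:: x', y' & t'] -> [/\ x = x', y = y' & t = t'].
  by case=> -> -> ->.
case/cons2 => eqa eqn; move: eqa eqn => /= eqa eqn; subst a' n'.
case/code_bdd_inj => ->.
case/(flatten_code_inj (@code_set_inj n)) => eqO.
case/code_set_inj => ->.
rewrite -[code_form f]cats0 -[code_form f']cats0 => /code_form_inj [-> _].
suff -> : O = O' by [].
by apply/ffunP => i; apply: eqO; rewrite mem_enum.
Qed.

Lemma size_unary_seq (s : seq nat) :
  size (flatten [seq unary n | n <- s]) = sumn s + size s.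
Proof.
elim: s => //= n s IH.
by rewrite size_cat IH /unary size_rcons size_nseq; lia.
Qed.

Lemma sumn_le_mul (s : seq nat) b :
  all (fun n => n <= b) s -> sumn s <= b * size s.
Proof.
elim: s => //= n s IH /andP[nb /IH].
by rewrite mulnS; lia.
Qed.

Lemma size_flatten_enum (I : finType) (F : I -> seq nat) :
  size (flatten [seq F i | i <- enum I]) = \sum_i size (F i).
Proof.
by rewrite size_flatten /shape -map_comp sumnE big_map big_enum.
Qed.

Lemma size_code_set n (B : {set 'I_n}) : size (code_set B) = #|B|.+1.
Proof. by rewrite /= size_map -cardE. Qed.

Lemma size_code_form a n (f : form 'I_a 'I_n) :
  flen f <= size (code_form f) <= 2 * flen f.
Proof.
elim: f => //= [f|f IHf g IHg|i f] *; rewrite ?size_cat; lia.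
Qed.

Lemma size_code_instance (I : instance) :
  bdd_size (law_bdd I) + \sum_i #|observables I i| + flen (query I)
    <= size (code_instance I)
    <= 4 * (instance_size I + nagents I) + 5.
Proof.
have dB : bdd_size (law_bdd I)
    <= size (flatten [seq code_node (label (law_bdd I) x)
                     | x <- enum 'I_(bdd_size (law_bdd I))])
    <= 4 * bdd_size (law_bdd I).
  rewrite size_flatten_enum.
  have h x : 1 <= size (code_node (label (law_bdd I) x)) <= 4 by case: (label _ x).
  apply/andP; split.
    rewrite -[X in X <= _]card_ord -sum1_card; apply: leq_sum => x _.
    by case/andP: (h x).
  rewrite mulnC -[X in _ <= X * _]card_ord -sum_nat_const; apply: leq_sum => x _.
  by case/andP: (h x).
have dO : size (flatten [seq code_set (observables I i) | i <- enum 'I_(nagents I)])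
    = \sum_i #|observables I i| + nagents I.
  rewrite size_flatten_enum -[X in _ = _ + X]card_ord -sum1_card -big_split /=.
  by apply: eq_bigr => i _; rewrite size_map -cardE addn1.
have ds : #|actual I| <= natoms I by rewrite -[X in _ <= X]card_ord max_card.
have df := size_code_form (query I).
have ds' := size_code_set (actual I).
have -> : size (code_instance I)
    = (size (code_bdd (law_bdd I)) + (nagents I + \sum_i #|observables I i|
       + (#|actual I|.+1 + size (code_form (query I))))).+2.
  by rewrite -ds' (addnC (nagents I)) -dO -!size_cat.
rewrite /instance_size -[size (code_bdd _)]/((size (flatten _)).+2).
move: dB df ds; set X := size (flatten _); set Y := size (code_form _).
set Z := \sum_i _; set W := #|actual I|; set U := bdd_size _; set T := flen _.
by move: X Y Z W U T; lia.
Qed.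

Lemma all_code_set n (B : {set 'I_n}) b : n <= b -> all (fun k => k <= b) (code_set B).
Proof.
move=> nb; rewrite /= (leq_trans (max_card _)) ?card_ord //=.
by apply/allP => _ /mapP[x _ ->]; have := ltn_ord x; rewrite /=; lia.
Qed.

Lemma all_code_form a n (f : form 'I_a 'I_n) b :
  5 <= b -> a <= b -> n <= b -> all (fun k => k <= b) (code_form f).
Proof.
move=> b5 ab nb; elim: f => /= [||p|f ->|f IHf g IHg|i f ->];
  rewrite ?all_cat ?IHf ?IHg ?andbT //=; try have := ltn_ord p;
  try have := ltn_ord i; lia.
Qed.

Lemma instance_size_le (I : instance) : instance_size I <= size (encode I).
Proof.
have := size_code_instance I.
rewrite /encode size_unary_seq /instance_size [sumn _]/= => /andP[h _].
lia.
Qed.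

Lemma size_encode_le (I : instance) :
  size (encode I) <= 4 * (instance_size I + nagents I + 6) ^ 2.
Proof.
have /andP[_ h] := size_code_instance I.
set N := instance_size I + nagents I in h *.
have hall : all (fun k => k <= N + 5) (code_instance I).
  have nN : natoms I <= N by rewrite /N /instance_size; lia.
  have mN : bdd_size (law_bdd I) <= N by rewrite /N /instance_size; lia.
  have aN : nagents I <= N by rewrite /N; lia.
  have all_flat (J : finType) (F : J -> seq nat) :
      (forall j, all (fun k => k <= N + 5) (F j)) ->
      all (fun k => k <= N + 5) (flatten [seq F j | j <- enum J]).
    by move=> hF; elim: (enum J) => //= j e IH; rewrite all_cat hF.
  have rt := ltn_ord (root (law_bdd I)).
  have all_bdd : all (fun k => k <= N + 5) (code_bdd (law_bdd I)).
    rewrite /= !(leq_trans _ (leq_addr 5 N)) ?(ltnW (leq_trans rt _)) //=.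
    apply: all_flat => x; case: (label _ x) => [[]|v lo hi] /=; [lia | lia |].
    by have := ltn_ord v; have := ltn_ord lo; have := ltn_ord hi; lia.
  have all_obs := all_flat _ (fun i => code_set (observables I i))
    (fun i => all_code_set (observables I i) (leq_trans nN (leq_addr 5 N))).
  have all_act := all_code_set (actual I) (leq_trans nN (leq_addr 5 N)).
  have all_q : all (fun k => k <= N + 5) (code_form (query I)).
    by apply: all_code_form; lia.
  have cat3 (p q r t : seq nat) x y : x <= N + 5 -> y <= N + 5 ->
      all (fun k => k <= N + 5) p -> all (fun k => k <= N + 5) q ->
      all (fun k => k <= N + 5) r -> all (fun k => k <= N + 5) t ->
      all (fun k => k <= N + 5) [:: x, y & p ++ q ++ r ++ t].
    by move=> /= -> ->; rewrite !all_cat => -> -> -> ->.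
  by apply: cat3 => //; lia.
rewrite /encode size_unary_seq.
have := sumn_le_mul hall; move: h; set k := size _; set u := sumn _ => h hu.
by rewrite expnS expn1; nia.
Qed.

(* Main.v *)
From mathcomp Require Import all_boot.
From mathcomp Require Import zify.
Require Import Defs.

(** With the state law [true], an agent who observes every atom outside a set [X]
    quantifies universally over [X], so the problem contains quantified Boolean
    formulas whose quantifiers act on whole blocks of atoms, with three agents
    instead of one per variable. A configuration of a machine running in space [m]
    is stored as [m] cells indexed by the distance to the heads, which makes one
    step a local rule. Savitch's midpoint recursion, with blocks reused at every
    level, expresses "[Y] is reached from [X] in [2 ^ k] steps". In prefix notation
    the recursive call comes last, so the code of the formula is a fixed word
    repeated [k] times, and the instance is printed by nested loops over unary
    counters. These run on a multi-tape machine assembled from fragments closed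
    under sequence, branching and iteration. *)

(** Hardness quantifies over all space-bounded machines, so the reduction starts from such a
    machine, and its polynomial-time claim must itself be witnessed by another machine. This second
    obligation shapes the formula: every piece is a fixed word, or a word whose only variable
    entries are offsets linear in the slot index. The space bound of the given machine is not
    assumed computable; the reduction computes instead a polynomial above it, [C * (n + 1) ^ d], and
    takes this as the number of slots. The recursion speaks of exactly [2 ^ k] steps, whereas
    halting times vary. The gap is closed by two facts: a halted configuration is a fixed point, and
    a configuration is coded by [g * m] bits, with [g] the number of symbols of the automaton, so
    that a halting run has halted after [2 ^ (g * m)] steps. Hence [k = g * m] levels suffice, which
    is polynomial in the input. *)

Set Implicit Arguments.
Unset Strict Implicit.
Unset Printing Implicit Defensive.

(** * Structured multi-tape machines *)

Section Fragments.
Variables (K : nat) (aux : finType).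

Local Notation heads := {ffun 'I_K.+1 -> cell aux}.
Local Notation tapes := {ffun 'I_K.+1 -> tape aux}.
Local Notation actions := ('I_K.+1 -> cell aux * dir).

Definition stay (h : heads) : actions := fun k => (h k, Stay).

Definition read (ts : tapes) : heads := [ffun k => hcell (ts k)].

Definition perform (ts : tapes) (a : actions) : tapes :=
  [ffun k => act (ts k) (a k)].

Lemma perform_stay ts : perform ts (stay (read ts)) = ts.
Proof. by apply/ffunP => k; rewrite ffunE /stay ffunE; case: (ts k). Qed.

(* A machine with one exit, represented by the successor state [None]. *)
Record frag := Frag {
  fstate : finType;
  fstart : fstate;
  fdelta : fstate -> heads -> option fstate * actions
}.

Inductive runs (F : frag) : option (fstate F) -> tapes -> nat -> tapes -> Prop :=
  | runs_exit ts : runs None ts 0 ts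
  | runs_step q ts n ts' :
      runs (fdelta q (read ts)).1 (perform ts (fdelta q (read ts)).2) n ts' ->
      runs (Some q) ts n.+1 ts'.

Definition exec (F : frag) (ts : tapes) (n : nat) (ts' : tapes) : Prop :=
  runs (Some (fstart F)) ts n ts'.

Definition fdo (a : heads -> actions) : frag :=
  @Frag unit tt (fun _ h => (None, a h)).

(** The exit of [F] is redirected to the start of [G] within the same transition, so sequencing
    costs no step. *)
Definition fseq (F G : frag) : frag :=
  @Frag (fstate F + fstate G)%type (inl (fstart F)) (fun q h =>
    match q with
    | inl q => let: (o, a) := fdelta q h in
        (Some (oapp inl (inr (fstart G)) o), a)
    | inr q => let: (o, a) := fdelta q h in (omap inr o, a)
    end).

Definition fif (test : heads -> bool) (F G : frag) : frag :=
  @Frag (option (fstate F + fstate G)) None (fun q h =>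
    match q with
    | None =>
        (Some (Some (if test h then inl (fstart F) else inr (fstart G))), stay h)
    | Some (inl q) => let: (o, a) := fdelta q h in (omap (Some \o inl) o, a)
    | Some (inr q) => let: (o, a) := fdelta q h in (omap (Some \o inr) o, a)
    end).

(** State [None] performs the test. Wrapping the successor [o] as [Some o] turns an exit of the body
    into a return to that state. *)
Definition fwhile (test : heads -> bool) (F : frag) : frag :=
  @Frag (option (fstate F)) None (fun q h =>
    match q with
    | None => (if test h then Some (Some (fstart F)) else None, stay h)
    | Some q => let: (o, a) := fdelta q h in (Some o, a)
    end).

Lemma exec_do a ts : exec (fdo a) ts 1 (perform ts (a (read ts))).
Proof. exact/runs_step/runs_exit. Qed.

Lemma exec_seq F G ts n ts' n' ts'' :
  exec F ts n ts' -> exec G ts' n' ts'' -> exec (fseq F G) ts (n + n') ts''.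
Proof.
move=> rF rG.
have {}rG : runs (F := fseq F G) (omap inr (Some (fstart G))) ts' n' ts''.
  elim: rG => [t|q t k t' _ IH]; first exact: runs_exit.
  by apply: runs_step => /=; case: (fdelta q _) IH.
pose emb o : fstate (fseq F G) := oapp inl (inr (fstart G)) o.
suff: runs (Some (emb (Some (fstart F)))) ts (n + n') ts'' by [].
elim: rF rG => [t|q t k t' _ IH rG]; first exact.
by apply: runs_step => /=; case: (fdelta q _) (IH rG).
Qed.

Lemma exec_if test F G ts n ts' :
  exec (if test (read ts) then F else G) ts n ts' ->
  exec (fif test F G) ts n.+1 ts'.
Proof.
move=> h; apply: runs_step; rewrite /= perform_stay.
case: (test _) h => h.
  suff: runs (F := fif test F G) (omap (Some \o inl) (Some (fstart F))) ts n ts' by [].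
  elim: h => [t|q t k t' _ IH]; first exact: runs_exit.
  by apply: runs_step => /=; case: (fdelta q _) IH.
suff: runs (F := fif test F G) (omap (Some \o inr) (Some (fstart G))) ts n ts' by [].
elim: h => [t|q t k t' _ IH]; first exact: runs_exit.
by apply: runs_step => /=; case: (fdelta q _) IH.
Qed.

Lemma exec_while_stop test F ts :
  test (read ts) = false -> exec (fwhile test F) ts 1 ts.
Proof.
by move=> h; apply: runs_step; rewrite /= perform_stay h; exact: runs_exit.
Qed.

Lemma exec_while_loop (test : heads -> bool) F ts n ts' n' ts'' :
  test (read ts) -> exec F ts n ts' -> exec (fwhile test F) ts' n' ts'' ->
  exec (fwhile test F) ts (n + n').+1 ts''.
Proof.
move=> h rF rW; apply: runs_step; rewrite /= perform_stay h.
pose emb (o : option (fstate F)) : option (fstate (fwhile test F)) := Some o.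
suff: runs (emb (Some (fstart F))) ts (n + n') ts'' by [].
elim: rF rW => [t|q t k t' _ IH rW]; first exact.
by apply: runs_step => /=; case: (fdelta q _) (IH rW).
Qed.

Definition machine_of (F : frag) : machine :=
  @Machine K (option (fstate F)) aux (Some (fstart F))
    (fun q => ~~ isSome q) xpred0
    (fun q h => if q is Some q then fdelta q h else (None, stay h)).

Lemma run_machine_of F ts n ts' (o : option (fstate F)) :
  runs o ts n ts' ->
  iter n (@step (machine_of F)) (@Config (machine_of F) o ts)
  = @Config (machine_of F) None ts'.
Proof.
elim=> [t|q t k t' _ IH] //; rewrite iterSr -[RHS]IH; congr iter.
by rewrite /step /= /perform; case: (fdelta q _).
Qed.

Definition on (k : 'I_K.+1) (f : cell aux -> cell aux * dir) : frag :=
  fdo (fun h k' => if k' == k then f (h k) else (h k', Stay)).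

Lemma exec_on k f ts :
  exec (on k f) ts 1
    [ffun k' => if k' == k then act (ts k) (f (hcell (ts k))) else ts k'].
Proof.
have := exec_do (fun h k' => if k' == k then f (h k) else (h k', Stay)) ts.
congr (exec _ _ _ _); apply/ffunP => k'; rewrite !ffunE.
by case: eqP => [->|_] //; case: (ts k').
Qed.

End Fragments.

(* Tape 0 receives the output, tape 1 holds the input, and tapes 2 to 6 are
   counters whose value is the distance of the head from the only mark. *)
Local Notation frag7 := (frag 6 unit).
Local Notation tapes7 := {ffun 'I_7 -> tape unit}.

Definition mark : cell unit := Some (inr tt).

Definition counter_tape (v : nat) (t : tape unit) : Prop :=
  exists b, t = if v is v'.+1
                then Tape (rcons (nseq v' None) mark) None (nseq b None)
                else Tape [::] mark (nseq b None).

Lemma counter_tape_zero v t : counter_tape v t -> isSome (hcell t) = (v == 0).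
Proof. by case=> b ->; case: v. Qed.

Lemma counter_tape_inc v t :
  counter_tape v t -> counter_tape v.+1 (act t (hcell t, MoveR)).
Proof. by case=> b ->; exists b.-1; case: v => [|v]; case: b. Qed.

Lemma counter_tape_dec v t :
  counter_tape v.+1 t -> counter_tape v (act t (hcell t, MoveL)).
Proof. by case=> b ->; exists b.+1; case: v. Qed.

Definition out_tape : 'I_7 := ord0.
Definition in_tape : 'I_7 := @Ordinal 7 1 isT.
Definition reg_tape (r : 'I_5) : 'I_7 := rshift 2 r.

Lemma reg_tape_out r : (reg_tape r == out_tape) = false.
Proof. by []. Qed.
Lemma reg_tape_in r : (reg_tape r == in_tape) = false.
Proof. by []. Qed.
Lemma reg_tape_eq r r' : (reg_tape r == reg_tape r') = (r == r').
Proof. exact: (@eq_rshift 2 5 r r'). Qed.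

(** * Stores and timed specifications of programs *)

Record store := Store { regs : seq nat; inp : seq bool; out : seq bool }.

Definition reg (s : store) (r : 'I_5) : nat := nth 0 (regs s) r.

(** The output head stands just after the last bit emitted; the [a] blanks before the output are
    what erasing the input leaves behind. The input is read once from left to right, so the part [l]
    already passed is arbitrary. *)
Definition represents (s : store) (ts : tapes7) : Prop :=
  [/\ exists a b, ts out_tape
        = Tape (rev (bits unit (out s)) ++ nseq a None) None (nseq b None),
      exists l b, ts in_tape
        = Tape l (head None (bits unit (inp s)))
                 (behead (bits unit (inp s)) ++ nseq b None) &
      forall r, counter_tape (reg s r) (ts (reg_tape r))].

(** [T] is only an upper bound, so all passes of a loop can share one cost. *)
Variant runs_to (p : frag7) (s : store) (T : nat) (s' : store) : Prop :=
  RunsTo of forall ts, represents s ts ->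
    exists n ts', [/\ n <= T, exec p ts n ts' & represents s' ts'].

Lemma runs_to_le p s T T' s' : runs_to p s T s' -> T <= T' -> runs_to p s T' s'.
Proof.
move=> [h] le; split=> ts /h[n [ts' [nT e r]]]; exists n, ts'; split=> //.
exact: leq_trans nT le.
Qed.

Lemma runs_to_seq p q s T s' T' s'' :
  runs_to p s T s' -> runs_to q s' T' s'' -> runs_to (fseq p q) s (T + T') s''.
Proof.
move=> [hp] [hq]; split=> ts /hp[n [ts' [le e /hq[n' [ts'' [le' e' r]]]]]].
exists (n + n'), ts''; split=> //; first exact: leq_add.
exact: exec_seq e e'.
Qed.

Definition pskip : frag7 := fdo (@stay _ _).

Lemma runs_to_skip s : runs_to pskip s 1 s.
Proof.
split=> ts r; exists 1, ts; split=> //.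
by have := exec_do (@stay 6 unit) ts; rewrite perform_stay.
Qed.

Definition pinc (r : 'I_5) : frag7 := on (reg_tape r) (fun c => (c, MoveR)).
Definition pdec (r : 'I_5) : frag7 := on (reg_tape r) (fun c => (c, MoveL)).
Definition pemit (b : bool) : frag7 := on out_tape (fun _ => (Some (inl b), MoveR)).
Definition pnext : frag7 := on in_tape (fun c => (c, MoveR)).

Lemma runs_to_inc r rs u o :
  runs_to (pinc r) (Store rs u o) 1
    (Store (set_nth 0 rs r (nth 0 rs r).+1) u o).
Proof.
split=> ts [ho hi hr]; eexists 1, _; split; [by []|exact: exec_on|].
split; rewrite ?ffunE //.
move=> r'; rewrite ffunE reg_tape_eq /reg /= nth_set_nth /=.
case: (r' =P r) => [->|/eqP ne].
  by rewrite eqxx; apply: counter_tape_inc; apply: hr.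
by move: (hr r'); rewrite (inj_eq val_inj) (negbTE ne).
Qed.

Lemma runs_to_dec (r : 'I_5) rs u o :
  0 < nth 0 rs r ->
  runs_to (pdec r) (Store rs u o) 1
    (Store (set_nth 0 rs r (nth 0 rs r).-1) u o).
Proof.
move=> ev; split=> ts [ho hi hr]; eexists 1, _; split; [by []|exact: exec_on|].
split; rewrite ?ffunE //.
move=> r'; rewrite ffunE reg_tape_eq /reg /= nth_set_nth /=.
case: (r' =P r) => [->|/eqP ne].
  by rewrite eqxx; apply: counter_tape_dec; rewrite prednK //; apply: hr.
by move: (hr r'); rewrite (inj_eq val_inj) (negbTE ne).
Qed.

Lemma runs_to_emit b rs u o :
  runs_to (pemit b) (Store rs u o) 1 (Store rs u (rcons o b)).
Proof.
split=> ts [[a [c ho]] hi hr]; eexists 1, _; split; [by []|exact: exec_on|].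
split; rewrite ?ffunE //=.
  by exists a, c.-1; rewrite ho /bits map_rcons rev_rcons; case: c {ho}.
by move=> r; rewrite ffunE reg_tape_out; apply: hr.
Qed.

Lemma runs_to_next rs u o :
  runs_to pnext (Store rs u o) 1 (Store rs (behead u) o).
Proof.
split=> ts [ho [l [b hi]] hr]; eexists 1, _; split; [by []|exact: exec_on|].
split; rewrite ?ffunE //=; last by move=> r; rewrite ffunE reg_tape_in; apply: hr.
rewrite hi; case: (u) => [|x [|y v]] /=.
- by exists (None :: l), b.-1; case: (b).
- by exists (Some (inl x) :: l), b.-1; case: (b).
- by exists (Some (inl x) :: l), b.
Qed.

Definition pwhile (r : 'I_5) (p : frag7) : frag7 :=
  fwhile (fun h => ~~ isSome (h (reg_tape r))) p.

(** The invariant is the sequence [s] of stores between passes. The induction is on the number of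
    passes that remain, since a run of the loop is assembled from its final, failing test backwards;
    that test is the last summand [1]. *)
Lemma runs_to_while r p (s : nat -> store) m T :
  (forall j, j < m -> 0 < reg (s j) r /\ runs_to p (s j) T (s j.+1)) ->
  reg (s m) r = 0 ->
  runs_to (pwhile r p) (s 0) (m * T.+1 + 1) (s m).
Proof.
move=> hb hm.
suff H k : k <= m -> runs_to (pwhile r p) (s (m - k)) (k * T.+1 + 1) (s m).
  by have := H m (leqnn m); rewrite subnn.
elim: k => [|k IH] lek; split=> ts rts.
  rewrite subn0 in rts; exists 1, ts; split=> //; apply: exec_while_stop.
  by case: rts => _ _ /(_ r) /counter_tape_zero; rewrite ffunE hm => ->.
have [] := hb (m - k.+1) _; first by lia.
rewrite -subSn // subSS => pos [hp].
have [n [ts' [le e r']]] := hp ts rts.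
have [/(_ ts' r')[n' [ts'' [le' e' r'']]]] := IH (ltnW lek).
exists (n + n').+1, ts''; split=> //; first by rewrite mulSn; lia.
apply: exec_while_loop e e'.
case: rts => _ _ /(_ r) /counter_tape_zero; rewrite ffunE => ->.
by rewrite -lt0n.
Qed.

Definition pifz (r : 'I_5) (p q : frag7) : frag7 :=
  fif (fun h => isSome (h (reg_tape r))) p q.

Lemma runs_to_ifz r p q s T s' :
  runs_to (if reg s r == 0 then p else q) s T s' ->
  runs_to (pifz r p q) s T.+1 s'.
Proof.
move=> [h]; split=> ts rts; have [n [ts' [le e r']]] := h ts rts.
exists n.+1, ts'; split=> //; apply: exec_if; rewrite ffunE.
by case: rts => _ _ /(_ r) /counter_tape_zero ->.
Qed.

Definition pcase (f : option bool -> frag7) : frag7 :=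
  fif (fun h => isSome (h in_tape))
    (fif (fun h => if h in_tape is Some (inl b) then b else false)
       (f (Some true)) (f (Some false)))
    (f None).

Lemma runs_to_case f s T s' :
  runs_to (f (ohead (inp s))) s T s' -> runs_to (pcase f) s T.+2 s'.
Proof.
move=> [h]; split=> ts rts; have [n [ts' [le e r']]] := h ts rts.
have [_ [l [b hi]] _] := rts.
case: (inp s) hi e => [|x u] /= hi e.
  exists n.+1, ts'; split=> //; first exact: leqW.
  by apply: exec_if; rewrite ffunE hi.
exists n.+2, ts'; split=> //; apply: exec_if; rewrite ffunE hi /=.
by apply: exec_if; rewrite ffunE hi /=; case: x {hi} e.
Qed.

Definition pseq (ps : seq frag7) : frag7 := foldr (@fseq _ _) pskip ps.

Lemma runs_to_nil s : runs_to (pseq [::]) s 1 s.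
Proof. exact: runs_to_skip. Qed.

Lemma runs_to_cons p ps s T s' T' s'' :
  runs_to p s T s' -> runs_to (pseq ps) s' T' s'' ->
  runs_to (pseq (p :: ps)) s (T + T') s''.
Proof. exact: runs_to_seq. Qed.

(** Symbolic execution of a straight-line program, with inner loops and fragments taken from the
    context; what remains is the comparison of the time bounds. *)
Ltac run :=
  eapply runs_to_le;
  [repeat (eapply runs_to_cons;
           [first [apply: runs_to_inc | apply: runs_to_dec; by []
                  | match goal with h : runs_to _ _ _ _ |- _ => exact: h end]|]);
   apply: runs_to_nil|].

(* [rB] holds the number of slots, [ri] the slot index of the innermost loop,
   [rt] is a scratch register, [rL] counts recursion levels, and [rn] holds the
   length of the input. *)
Definition rB : 'I_5 := @Ordinal 5 0 isT.
Definition ri : 'I_5 := @Ordinal 5 1 isT.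
Definition rt : 'I_5 := @Ordinal 5 2 isT.
Definition rL : 'I_5 := @Ordinal 5 3 isT.
Definition rn : 'I_5 := @Ordinal 5 4 isT.

(** * Printing words with offsets, slot by slot *)

Definition pemits (bs : seq bool) : frag7 := pseq [seq pemit b | b <- bs].

Lemma runs_to_emits bs rs u o :
  runs_to (pemits bs) (Store rs u o) (size bs).+1 (Store rs u (o ++ bs)).
Proof.
elim: bs o => [|b bs IH] o /=; first by rewrite cats0; apply: runs_to_nil.
rewrite -cat_rcons /pemits map_cons.
by refine (runs_to_le (runs_to_cons (runs_to_emit b rs u o) (IH _)) _); lia.
Qed.

Definition pmove (r r' : 'I_5) : frag7 := pwhile r (pseq [:: pdec r; pinc r']).

Lemma runs_to_move_t_i B i t L n u o :
  runs_to (pmove rt ri) (Store [:: B; i; t; L; n] u o) (t * 4 + 1)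
    (Store [:: B; i + t; 0; L; n] u o).
Proof.
pose s j := Store [:: B; i + j; t - j; L; n] u o.
have -> : Store [:: B; i; t; L; n] u o = s 0 by rewrite /s addn0 subn0.
have -> : Store [:: B; i + t; 0; L; n] u o = s t by rewrite /s subnn.
apply: runs_to_while => [j lt|]; last exact: subnn.
split; first by rewrite /reg /= subn_gt0.
(* Written as a successor, the counter is visibly positive, as [pdec] requires. *)
have e : t - j = (t - j.+1).+1 by rewrite -subSn.
rewrite /s addnS e.
by run; lia.
Qed.

Lemma runs_to_move_i_B B i t L n u o :
  runs_to (pmove ri rB) (Store [:: B; i; t; L; n] u o) (i * 4 + 1)
    (Store [:: B + i; 0; t; L; n] u o).
Proof.
pose s j := Store [:: B + j; i - j; t; L; n] u o.
have -> : Store [:: B; i; t; L; n] u o = s 0 by rewrite /s addn0 subn0.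
have -> : Store [:: B + i; 0; t; L; n] u o = s i by rewrite /s subnn.
apply: runs_to_while => [j lt|]; last exact: subnn.
split; first by rewrite /reg /= subn_gt0.
have e : i - j = (i - j.+1).+1 by rewrite -subSn.
rewrite /s addnS e.
by run.
Qed.

(** A counter can be read only by running it down, so the slot index is parked in [rt] and moved
    back. *)
Definition pidx (W : nat) : frag7 :=
  pseq [:: pwhile ri (pseq [:: pdec ri; pinc rt; pemits (nseq W true)]);
           pmove rt ri].

Lemma runs_to_idx W B i L n u o :
  runs_to (pidx W) (Store [:: B; i; 0; L; n] u o) (i * (W + 9) + 3)
    (Store [:: B; i; 0; L; n] u (o ++ nseq (W * i) true)).
Proof.
pose s j := Store [:: B; i - j; j; L; n] u (o ++ nseq (W * j) true).
have h : runs_to (pwhile ri (pseq [:: pdec ri; pinc rt; pemits (nseq W true)]))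
    (s 0) (i * (W + 4).+1 + 1) (s i).
  apply: runs_to_while => [j lt|]; last exact: subnn.
  split; first by rewrite /reg /= subn_gt0.
  have e : i - j = (i - j.+1).+1 by rewrite -subSn.
  rewrite /s e mulnSr nseqD catA.
  have := runs_to_emits (nseq W true) [:: B; i - j.+1; j.+1; L; n] u
    (o ++ nseq (W * j) true).
  rewrite size_nseq => h.
  run.
  by lia.
rewrite /s subn0 muln0 cats0 subnn in h.
have h' := runs_to_move_t_i B 0 i L n u (o ++ nseq (W * i) true).
rewrite add0n in h'.
by run; nia.
Qed.

(* In a template, [None] stands for the unary offset [W * i] of slot [i]. *)
Definition fill (W i : nat) (x : option bool) : seq bool :=
  if x is Some b then [:: b] else nseq (W * i) true.

Definition ptemplate (W : nat) (xs : seq (option bool)) : frag7 :=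
  pseq [seq if x is Some b then pemit b else pidx W | x <- xs].

Lemma runs_to_template W xs B i L n u o :
  runs_to (ptemplate W xs) (Store [:: B; i; 0; L; n] u o)
    (size xs * (i * (W + 9) + 3) + 1)
    (Store [:: B; i; 0; L; n] u (o ++ flatten [seq fill W i x | x <- xs])).
Proof.
elim: xs o => [|x xs IH] o /=; first by rewrite cats0; apply: runs_to_nil.
rewrite catA mulSn -addnA; apply: runs_to_cons (IH _).
case: x => [b|]; last exact: runs_to_idx.
by rewrite cats1; refine (runs_to_le (runs_to_emit _ _ _ _) _); rewrite addn3.
Qed.

(** Between passes [rB] and [ri] add up to the number of slots. [post] runs while [ri] holds that
    full number, which lets it print the offset of the last border slot; the final move restores
    [rB]. *)
Definition pslots (body post : frag7) : frag7 :=
  pseq [:: pwhile rB (pseq [:: pdec rB; body; pinc ri]); post; pmove ri rB].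

(** [L] and [u] may change with the pass: one loop uses this to load the level counter, another to
    consume one input bit per slot. *)
Lemma runs_to_slots body post m (L : nat -> nat) n (u e : nat -> seq bool) e' T T' o :
  (forall j o', j < m ->
    runs_to body (Store [:: m - j.+1; j; 0; L j; n] (u j) o') T
      (Store [:: m - j.+1; j; 0; L j.+1; n] (u j.+1) (o' ++ e j))) ->
  (forall o', runs_to post (Store [:: 0; m; 0; L m; n] (u m) o') T'
      (Store [:: 0; m; 0; L m; n] (u m) (o' ++ e'))) ->
  runs_to (pslots body post) (Store [:: m; 0; 0; L 0; n] (u 0) o)
    (m * (T + 8) + T' + 3)
    (Store [:: m; 0; 0; L m; n] (u m)
       (o ++ flatten [seq e j | j <- iota 0 m] ++ e')).
Proof.
move=> hb hp.
pose s j := Store [:: m - j; j; 0; L j; n] (u j)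
                  (o ++ flatten [seq e k | k <- iota 0 j]).
have h : runs_to (pwhile rB (pseq [:: pdec rB; body; pinc ri]))
    (s 0) (m * (T + 3).+1 + 1) (s m).
  apply: runs_to_while => [j lt|]; last exact: subnn.
  split; first by rewrite /reg /= subn_gt0.
  have es : m - j = (m - j.+1).+1 by rewrite -subSn.
  have -> : s j.+1 = Store [:: m - j.+1; j.+1; 0; L j.+1; n] (u j.+1)
      ((o ++ flatten [seq e k | k <- iota 0 j]) ++ e j).
    by rewrite /s -addn1 iotaD map_cat flatten_cat /= add0n cats0 catA.
  rewrite /s es.
  have {}hb := hb j (o ++ flatten [seq e k | k <- iota 0 j]) lt.
  run.
  by lia.
rewrite /s subn0 /= cats0 subnn in h.
have h' := runs_to_move_i_B 0 m 0 (L m) n (u m)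
  ((o ++ flatten [seq e k | k <- iota 0 m]) ++ e').
rewrite add0n -catA in h'; have {}hp := hp (o ++ flatten [seq e k | k <- iota 0 m]).
rewrite -catA in hp.
run.
by nia.
Qed.

(** * Computing the number of slots *)

Definition pmul : frag7 :=
  pseq [:: pwhile rB (pseq [:: pdec rB; pinc ri;
             pwhile rn (pseq [:: pdec rn; pinc rt; pinc ri]);
             pwhile rt (pseq [:: pdec rt; pinc rn])]);
           pmove ri rB].

Lemma runs_to_mul B L n u o :
  runs_to pmul (Store [:: B; 0; 0; L; n] u o) (B * (n * 13 + 10) + 3)
    (Store [:: B * n.+1; 0; 0; L; n] u o).
Proof.
pose s j := Store [:: B - j; j * n.+1; 0; L; n] u o.
have h : runs_to (pwhile rB (pseq [:: pdec rB; pinc ri;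
             pwhile rn (pseq [:: pdec rn; pinc rt; pinc ri]);
             pwhile rt (pseq [:: pdec rt; pinc rn])]))
    (s 0) (B * (n * 9 + 5).+1 + 1) (s B).
  apply: runs_to_while => [j lt|]; last exact: subnn.
  split; first by rewrite /reg /= subn_gt0.
  have e : B - j = (B - j.+1).+1 by rewrite -subSn.
  rewrite /s e; set b := B - j.+1; set i := j * n.+1.
  pose s1 k := Store [:: b; i.+1 + k; k; L; n - k] u o.
  have h1 : runs_to (pwhile rn (pseq [:: pdec rn; pinc rt; pinc ri]))
      (s1 0) (n * 5 + 1) (s1 n).
    apply: runs_to_while => [k ltk|]; last exact: subnn.
    split; first by rewrite /reg /= subn_gt0.
    have ek : n - k = (n - k.+1).+1 by rewrite -subSn.
    rewrite /s1 ek (addnS i.+1 k).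
    by run.
  pose s2 k := Store [:: b; i.+1 + n; n - k; L; k] u o.
  have h2 : runs_to (pwhile rt (pseq [:: pdec rt; pinc rn]))
      (s2 0) (n * 4 + 1) (s2 n).
    apply: runs_to_while => [k ltk|]; last exact: subnn.
    split; first by rewrite /reg /= subn_gt0.
    have ek : n - k = (n - k.+1).+1 by rewrite -subSn.
    rewrite /s2 ek.
    by run.
  rewrite /s1 subn0 subnn addn0 in h1.
  rewrite /s2 subn0 subnn in h2.
  have -> : j.+1 * n.+1 = i.+1 + n by rewrite mulSn addnC addSnnS.
  run.
  by lia.
rewrite /s subn0 subnn mul0n in h.
have h' := runs_to_move_i_B 0 (B * n.+1) 0 L n u o.
rewrite add0n in h'.
by run; nia.
Qed.

(** The factor is [n + 1] rather than [n], so that for positive [c] there is at least one slot even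
    on the empty input. *)
Definition psize (c d : nat) : frag7 :=
  pseq (nseq c (pinc rB) ++ nseq d pmul).

Lemma runs_to_size c d n u o :
  runs_to (psize c d) (Store [:: 0; 0; 0; 0; n] u o)
    (c + d * (c * n.+1 ^ d * (n * 13 + 10) + 3) + 1)
    (Store [:: c * n.+1 ^ d; 0; 0; 0; n] u o).
Proof.
set M := c * n.+1 ^ d * _ + 3.
(* Intermediate products stay below the final one, so every multiplication can be charged [M], its
   cost at the final value. *)
have hm k B : B * n.+1 ^ k <= c * n.+1 ^ d ->
    runs_to (pseq (nseq k pmul)) (Store [:: B; 0; 0; 0; n] u o) (k * M + 1)
      (Store [:: B * n.+1 ^ k; 0; 0; 0; n] u o).
  elim: k B => [|k IH] B le; first by rewrite expn0 muln1; apply: runs_to_nil.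
  rewrite expnS mulnA in le *.
  refine (runs_to_le (runs_to_cons (runs_to_mul _ _ _ _ _) (IH _ le)) _).
  have : B <= c * n.+1 ^ d.
    apply: leq_trans le; rewrite -mulnA leq_pmulr // muln_gt0 /=.
    by rewrite expn_gt0.
  by rewrite /M; nia.
have hc k : runs_to (pseq (nseq k (pinc rB) ++ nseq d pmul))
    (Store [:: c - k; 0; 0; 0; n] u o) (k + d * M + 1)
    (Store [:: (c - k + k) * n.+1 ^ d; 0; 0; 0; n] u o) \/ k > c.
  elim: k => [|k [IH|]]; [|case: (ltnP k c) => lt; [left|by right]|by right; lia].
    by left; rewrite subn0 addn0 add0n; apply: hm.
  have e : c - k = (c - k.+1).+1 by lia.
  rewrite e addSnnS in IH.
  have inc := runs_to_inc rB [:: c - k.+1; 0; 0; 0; n] u o.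
  by refine (runs_to_le (runs_to_cons inc IH) _); lia.
by case: (hc c) => [|]; rewrite ?ltnn // subnn add0n.
Qed.

(** * Preparing the tapes *)

Definition pmarks : frag7 :=
  fdo (fun h k => (if k < 2 then h k else mark, Stay)).

(** The input arrives on the tape that must finally hold the output and nothing else, so it is moved
    away with erasure; the same pass leaves its length in [rn]. *)
Definition pcopy : frag7 :=
  fwhile (fun h => isSome (h out_tape)) (fdo (fun h k =>
    if k == out_tape then (None, MoveR)
    else if k == in_tape then (h out_tape, MoveR)
    else if k == reg_tape rn then (h k, MoveR) else (h k, Stay))).

Definition prewind : frag7 :=
  fwhile (fun h => isSome (h in_tape)) (on in_tape (fun c => (c, MoveL))).

Definition psetup : frag7 :=
  fseq pmarks (fseq pcopy (fseq (on in_tape (fun c => (c, MoveL)))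
    (fseq prewind (on in_tape (fun c => (c, MoveR)))))).

Definition tapes_of (t0 t1 t6 : tape unit) : tapes7 :=
  [ffun k => if k == out_tape then t0 else if k == in_tape then t1
             else if k == reg_tape rn then t6 else Tape [::] mark [::]].

Definition counter_of (v : nat) : tape unit :=
  if v is v'.+1 then Tape (rcons (nseq v' None) mark) None [::]
  else Tape [::] mark [::].

Lemma exec_on_in f t0 t1 t6 :
  exec (on in_tape f) (tapes_of t0 t1 t6) 1
    (tapes_of t0 (act t1 (f (hcell t1))) t6).
Proof.
have := exec_on in_tape f (tapes_of t0 t1 t6).
congr exec; apply/ffunP => k; rewrite !ffunE /=.
by case: (k =P in_tape) => [->|].
Qed.

Lemma exec_copy v u a j :
  exec pcopy
    (tapes_of (Tape (nseq a None) (head None (bits unit v)) (behead (bits unit v)))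
       (Tape (rev (bits unit u)) None [::]) (counter_of j))
    (2 * size v + 1)
    (tapes_of (Tape (nseq (a + size v) None) None [::])
       (Tape (rev (bits unit (u ++ v))) None [::]) (counter_of (j + size v))).
Proof.
elim: v u a j => [|b v IH] u a j.
  by rewrite /= !addn0 cats0; apply: exec_while_stop; rewrite !ffunE.
have -> : 2 * size (b :: v) + 1 = (1 + (2 * size v + 1)).+1 by rewrite /=; lia.
apply: exec_while_loop; [by rewrite !ffunE|exact: exec_do|].
rewrite [X in exec _ X](_ : _ = tapes_of
    (Tape (nseq a.+1 None) (head None (bits unit v)) (behead (bits unit v)))
    (Tape (rev (bits unit (rcons u b))) None [::]) (counter_of j.+1)).
  by rewrite -cat_rcons -[size (b :: v)]/(size v).+1 !(addnS _ (size v)) -!addSn; apply: IH.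
apply/ffunP => k; rewrite !ffunE /=; case: eqP => // _; case: eqP => _.
  by rewrite /bits map_rcons rev_rcons.
by case: eqP => // _; case: j.
Qed.

Lemma exec_rewind x y t0 t6 :
  exec prewind
    (tapes_of t0 (Tape (behead (bits unit x)) (head None (bits unit x))
                       (rcons (bits unit y) None)) t6)
    (2 * size x + 1)
    (tapes_of t0 (Tape [::] None (rcons (bits unit (rev x ++ y)) None)) t6).
Proof.
elim: x y => [|b x IH] y; first by apply: exec_while_stop; rewrite !ffunE.
have -> : 2 * size (b :: x) + 1 = (1 + (2 * size x + 1)).+1 by rewrite /=; lia.
apply: exec_while_loop; [by rewrite !ffunE|exact: exec_on_in|].
by rewrite rev_cons cat_rcons; have := IH (b :: y).
Qed.

Lemma setup_represents w :
  exists n ts, [/\ n <= 4 * size w + 5,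
    exec psetup (ctape (init (machine_of psetup) w)) n ts &
    represents (Store [:: 0; 0; 0; 0; size w] w [::]) ts].
Proof.
pose t0 := Tape (aux := unit) (nseq (size w) None) None [::].
pose c := counter_of (size w).
have e1 : exec pmarks (ctape (init (machine_of psetup) w)) 1
    (tapes_of (input_tape unit w) (blank_tape unit) (counter_of 0)).
  have := exec_do (fun h k => (if k < 2 then h k else mark, Stay))
    (ctape (init (machine_of psetup) w)).
  congr exec; apply/ffunP => k; rewrite !ffunE /=.
  by case: k => [[|[|k]]] kP //=; case: ifP.
have e2 := exec_copy w [::] 0 0; rewrite !add0n cat0s in e2.
have e3 := exec_on_in (fun c => (c, MoveL)) t0
  (Tape (rev (bits unit w)) None [::]) c.
have e4 := exec_rewind (rev w) [::] t0 c.
rewrite revK cats0 size_rev in e4.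
have e5 := exec_on_in (fun c => (c, MoveR)) t0
  (Tape [::] None (rcons (bits unit w) None)) c.
rewrite /bits map_rev in e4.
have e := exec_seq e1 (exec_seq e2 (exec_seq e3 (exec_seq e4 e5))).
eexists _, _; split; [|exact: e|]; first by lia.
split=> /=.
- by exists (size w), 0; rewrite ffunE.
- exists [:: None]; rewrite ffunE /=.
  by case: w {t0 c e1 e2 e3 e4 e5 e} => [|b w]; [exists 0|exists 1; rewrite /= -cats1].
- move=> r; rewrite ffunE reg_tape_out reg_tape_in reg_tape_eq.
  by case: r => [[|[|[|[|[|r]]]]]] rP //=; exists 0; rewrite /c; case: (size w).
Qed.

Lemma machine_of_computes (p : frag7) (f : seq bool -> seq bool) (T : nat -> nat) :
  (forall w, exists rs u,
     runs_to p (Store [:: 0; 0; 0; 0; size w] w [::]) (T (size w))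
       (Store rs u (f w))) ->
  polynomially_bounded (fun n => 4 * n + 5 + T n) ->
  polytime_computable f.
Proof.
move=> hp hT; exists (machine_of (fseq psetup p)), (fun n => 4 * n + 5 + T n).
split=> // w; have [rs [u [h]]] := hp w.
have [n [ts [le e rep]]] := setup_represents w.
have [n' [ts' [le' e' [[a [b ho]] _ _]]]] := h ts rep.
have := run_machine_of (exec_seq e e'); rewrite -/(init _ w) => E.
exists (n + n'); split; first exact: leq_add.
- by rewrite /run E.
(* The blank under the head accounts for the successor. *)
- rewrite /run E /= -[ord0]/out_tape ho; exists a, b.+1.
  by rewrite /tape_cells /= rev_cat revK rev_nseq -catA.
Qed.

(** * Block quantification and Savitch's recursion *)

Section Propositional.
Variables A V : Type.
Implicit Types f h : form A V.

Definition fOr f h : form A V := Neg (And (Neg f) (Neg h)).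
Definition fIff f h : form A V := fOr (And f h) (And (Neg f) (Neg h)).
Definition fAll (fs : seq (form A V)) : form A V := foldr (@And A V) Top fs.

Fixpoint prop_form f : bool :=
  match f with
  | Top | Bot | Atom _ => true
  | Neg f => prop_form f
  | And f h => prop_form f && prop_form h
  | K _ _ => false
  end.

Fixpoint peval (v : V -> bool) f : bool :=
  match f with
  | Top => true
  | Bot => false
  | Atom x => v x
  | Neg f => ~~ peval v f
  | And f h => peval v f && peval v h
  | K _ _ => false
  end.

(** Shannon expansion. It is exponential in the number of atoms, which is harmless: it is applied to
    at most [4 * g] of them, and [g] depends only on the simulated machine. *)
Fixpoint truth_table (vs : seq V) (R : seq bool -> bool) : form A V :=
  if vs is x :: vs then
    fOr (And (Atom x) (truth_table vs (R \o cons true)))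
        (And (Neg (Atom x)) (truth_table vs (R \o cons false)))
  else if R [::] then Top else Bot.

Lemma peval_or v f h : peval v (fOr f h) = peval v f || peval v h.
Proof. by rewrite /= -negb_or negbK. Qed.

Lemma peval_iff v f h : peval v (fIff f h) = (peval v f == peval v h).
Proof. by rewrite peval_or /=; case: (peval v f); case: (peval v h). Qed.

Lemma peval_all v fs : peval v (fAll fs) = all (peval v) fs.
Proof. by elim: fs => //= f fs ->. Qed.

Lemma prop_form_all fs : prop_form (fAll fs) = all prop_form fs.
Proof. by elim: fs => //= f fs ->. Qed.

Lemma prop_form_truth_table vs R : prop_form (truth_table vs R).
Proof. by elim: vs R => [|x vs IH] R /=; [case: (R _)|rewrite !IH]. Qed.

Lemma peval_truth_table v vs R : peval v (truth_table vs R) = R (map v vs).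
Proof.
elim: vs R => [|x vs IH] R; first by rewrite /=; case: (R _).
by rewrite /truth_table -/truth_table peval_or /= !IH /=; case: (v x); rewrite ?orbF.
Qed.

End Propositional.

(** Two renamings use this: placing a slot-relative formula at a slot, and turning numbers into the
    atoms of the instance. *)
Fixpoint fmap A V V' (h : V -> V') (f : form A V) : form A V' :=
  match f with
  | Top => Top
  | Bot => Bot
  | Atom x => Atom (h x)
  | Neg f => Neg (fmap h f)
  | And f f' => And (fmap h f) (fmap h f')
  | K a f => K a (fmap h f)
  end.

Lemma prop_form_fmap A V V' (h : V -> V') (f : form A V) :
  prop_form (fmap h f) = prop_form f.
Proof. by elim: f => //= f -> // f' ->. Qed.

Lemma peval_fmap A V V' (h : V -> V') v (f : form A V) :
  peval v (fmap h f) = peval (v \o h) f.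
Proof. by elim: f => //= [f ->|f -> f' ->]. Qed.

(* The atoms of slot [p] are numbered [p * W + b * g + j] for the blocks
   [b < 5] and the bits [j < g]. A block stores a configuration, one cell in each
   of the slots [1 .. m]; slots [0] and [m.+1] are the boundary, and remain false
   because all agents observe them. *)
Section Blocks.
Variables (g m : nat).

Definition width : nat := 5 * g.
Local Notation W := width.
(** The slots use the numbers below this one; the additional top atom gives the type of atoms the
    successor form that [inord] expects. *)
Definition last_atom : nat := m.+2 * W.
Local Notation N := last_atom.
Local Notation state := {set 'I_N.+1}.
Implicit Types (s t : state).

Definition bX := 0.
Definition bY := 1.
Definition bZ := 2.
Definition bA := 3.
Definition bB := 4.

(** In Savitch's recursion agent 0 quantifies over the midpoint, agent 1 over the half to be
    checked, and agent 2 over the arguments of the recursive call. *)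
Definition hides (a : 'I_3) (b : nat) : bool :=
  b \in nth [::] [:: [:: bZ]; [:: bA; bB]; [:: bX; bY]] a.

Definition visible (a : 'I_3) (x : nat) : bool :=
  (x < N) && [|| x < W, m.+1 * W <= x | ~~ hides a (x %% W %/ g)].

Definition observes (a : 'I_3) : state := [set x : 'I_N.+1 | visible a x].

Definition holds s (x : nat) : bool := inord x \in s.

(** The law [true] is built in: [K] ranges over all of the finitely many states, which makes
    satisfaction a Boolean. *)
Fixpoint sem s (f : form 'I_3 nat) : bool :=
  match f with
  | Top => true
  | Bot => false
  | Atom x => holds s x
  | Neg f => ~~ sem s f
  | And f h => sem s f && sem s h
  | K a f => [forall t, (s :&: observes a == t :&: observes a) ==> sem t f]
  end.

Lemma sem_Neg s f : sem s (Neg f) = ~~ sem s f.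
Proof. by []. Qed.

Lemma sem_K s a f :
  sem s (K a f) = [forall t, (s :&: observes a == t :&: observes a) ==> sem t f].
Proof. by []. Qed.

Lemma satP (F : kstruct 'I_3 'I_N.+1) s f :
  (forall t, law F t) -> obs F =1 observes ->
  reflect (sat F s (fmap (@inord N) f)) (sem s f).
Proof.
move=> lawF obsF; elim: f s => [||x|f IH|f IHf h IHh|a f IH] s /=.
- exact: ReflectT.
- exact: ReflectF.
- exact: idP.
- by apply: (iffP negP) => h /IH.
- by apply: (iffP andP) => -[/IHf hf /IHh hh].
- apply: (iffP forallP) => [h t _ e|h t].
    by apply/IH; have /implyP := h t; apply; rewrite -!obsF e.
  by apply/implyP => /eqP e; apply/IH/h; rewrite ?obsF.
Qed.

Lemma sem_prop s f : prop_form f -> sem s f = peval (holds s) f.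
Proof. by elim: f => //= [f IH /IH ->|f IHf h IHh /andP[/IHf-> /IHh->]]. Qed.

Lemma agree_obsP s t a :
  reflect (forall x, visible a x -> holds s x = holds t x)
          (s :&: observes a == t :&: observes a).
Proof.
apply: (iffP eqP) => [e x vx|h].
  have := congr1 (fun u : state => inord x \in u) e.
  have lt : x < N.+1 by case/andP: vx => /ltnW.
  by rewrite /= !inE inordK // vx !andbT.
apply/setP => x; rewrite !inE; case vx: (visible a x); rewrite ?andbF ?andbT //.
by have := h _ vx; rewrite /holds inord_val.
Qed.

Lemma width_bound b j : b < 5 -> j < g -> b * g + j < W.
Proof.
move=> hb hj; rewrite /W; have : b * g <= 4 * g by rewrite leq_mul2r; lia.
by lia.
Qed.

Definition slot s (b p : nat) : seq bool :=
  [seq holds s (p * W + (b * g + j)) | j <- iota 0 g].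

Definition conf s (b : nat) : seq (seq bool) :=
  [seq slot s b p.+1 | p <- iota 0 m].

Definition shaped (x : seq (seq bool)) : bool :=
  (size x == m) && all (fun y : seq bool => size y == g) x.

Lemma size_slot s b p : size (slot s b p) = g.
Proof. by rewrite size_map size_iota. Qed.

Lemma size_conf s b : size (conf s b) = m.
Proof. by rewrite size_map size_iota. Qed.

Lemma shaped_conf s b : shaped (conf s b).
Proof.
rewrite /shaped size_conf eqxx all_map; apply/allP => p _ /=.
by rewrite size_slot.
Qed.

Lemma nth_slot s b p j : j < g -> nth false (slot s b p) j = holds s (p * W + (b * g + j)).
Proof. by move=> h; rewrite (nth_map 0) ?size_iota // nth_iota. Qed.

Lemma nth_conf y s b p : p < m -> nth y (conf s b) p = slot s b p.+1.
Proof. by move=> h; rewrite (nth_map 0) ?size_iota // nth_iota. Qed.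

Definition border_false s : Prop :=
  forall x, x < N -> (x < W) || (m.+1 * W <= x) -> holds s x = false.

Lemma border_false_agree s t a :
  border_false s -> s :&: observes a == t :&: observes a -> border_false t.
Proof.
move=> bs /agree_obsP h x xN xb; rewrite -h ?bs // /visible xN /=.
by rewrite orbA xb.
Qed.

Lemma idx_divW p b j : b < 5 -> j < g -> (p * W + (b * g + j)) %/ W = p.
Proof.
move=> hb hj; have h := width_bound hb hj.
by rewrite divnMDl ?(leq_ltn_trans _ h) // divn_small ?addn0.
Qed.

Lemma idx_block p b j :
  b < 5 -> j < g -> (p * W + (b * g + j)) %% W %/ g = b.
Proof.
move=> hb hj; have h := width_bound hb hj.
by rewrite modnMDl modn_small // divnMDl ?(leq_ltn_trans _ hj) // divn_small ?addn0.
Qed.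

Lemma idx_bit p b j : j < g -> (p * W + (b * g + j)) %% g = j.
Proof. by move=> hj; rewrite /W mulnA modnMDl modnMDl modn_small. Qed.

Lemma idx_lt p b j q : b < 5 -> j < g -> p < q -> p * W + (b * g + j) < q * W.
Proof.
move=> hb hj hp; have h := width_bound hb hj.
have : p.+1 * W <= q * W by rewrite leq_mul2r hp orbT.
by rewrite mulSn; lia.
Qed.

Lemma conf_agree s t a b :
  b < 5 -> ~~ hides a b -> s :&: observes a == t :&: observes a ->
  conf t b = conf s b.
Proof.
move=> hb hab /agree_obsP h; apply/eq_in_map => p; rewrite mem_iota => /= hp.
apply/eq_in_map => j; rewrite mem_iota => /= hj; apply/esym/h.
by rewrite /visible idx_lt ?ltnS ?(ltnW hp) //= idx_block // hab !orbT.
Qed.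

(** The witness for quantifiers over block [b]. Cells are counted from 0 and inner slots from 1,
    whence the predecessor. *)
Definition update s b (D : seq (seq bool)) : state :=
  [set x : 'I_N.+1 |
    if (W <= x < m.+1 * W) && (x %% W %/ g == b)
    then nth false (nth [::] D (x %/ W).-1) (x %% g) else x \in s].

Lemma holds_update s b D x : x < N ->
  holds (update s b D) x =
    if (W <= x < m.+1 * W) && (x %% W %/ g == b)
    then nth false (nth [::] D (x %/ W).-1) (x %% g) else holds s x.
Proof. by move=> h; rewrite /holds inE inordK // ltnW. Qed.

Lemma update_agree s b D a : hides a b ->
  s :&: observes a == update s b D :&: observes a.
Proof.
move=> h; apply/agree_obsP => x /andP[xN v]; rewrite holds_update //.
case: ifP => // /andP[/andP[h1 h2] /eqP e].
by move: v; rewrite ltnNge h1 leqNgt h2 e h.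
Qed.

Lemma idx_inner p b j : b < 5 -> j < g -> p < m ->
  W <= p.+1 * W + (b * g + j) < m.+1 * W.
Proof. by move=> hb hj hp; rewrite idx_lt // andbT mulSn -addnA leq_addr. Qed.

Lemma conf_update s b D : b < 5 -> shaped D -> conf (update s b D) b = D.
Proof.
move=> hb /andP[/eqP sD /allP aD].
apply: (@eq_from_nth _ [::]); rewrite size_conf // => p hp.
rewrite nth_conf //.
have sp : size (nth [::] D p) = g by apply/eqP/aD/mem_nth; rewrite sD.
apply: (@eq_from_nth _ false); rewrite size_slot // => j hj.
rewrite nth_slot // holds_update; last by apply: idx_lt => //; lia.
by rewrite idx_inner // idx_block // eqxx /= idx_divW // idx_bit.
Qed.

Lemma conf_update_other s b b' D :
  b' < 5 -> b' != b -> conf (update s b D) b' = conf s b'.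
Proof.
move=> hb ne; apply/eq_in_map => p; rewrite mem_iota => /= hp.
apply/eq_in_map => j; rewrite mem_iota => /= hj.
rewrite holds_update; last by apply: idx_lt => //; lia.
by rewrite idx_block // (negbTE ne) andbF.
Qed.

(* Atoms [(true, o)] are relative to the slot at which the formula is placed. *)
Definition rform := form 'I_3 (bool * nat).

Definition place (i : nat) (f : rform) : form 'I_3 nat :=
  fmap (fun x => if x.1 then W * i + x.2 else x.2) f.

Definition all_slots (f : rform) : form 'I_3 nat :=
  fAll [seq place i f | i <- iota 0 m].

(** Since cell [i] lies in slot [i + 1], placing at [i] makes [q = 0, 1, 2] the left neighbour, the
    cell itself and the right neighbour; no negative offset arises. *)
Definition ratom (q b j : nat) : bool * nat := (true, q * W + (b * g + j)).

Definition slot_eq (b b' : nat) : rform :=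
  fAll [seq fIff (Atom (ratom 1 b j)) (Atom (ratom 1 b' j)) | j <- iota 0 g].

Lemma sem_fAll s fs : sem s (fAll fs) = all (sem s) fs.
Proof. by elim: fs => //= f fs ->. Qed.

Lemma sem_place s i f : prop_form f ->
  sem s (place i f) = peval (fun x => holds s (if x.1 then W * i + x.2 else x.2)) f.
Proof. by move=> h; rewrite sem_prop ?prop_form_fmap // peval_fmap. Qed.

Lemma holds_ratom s i q b j :
  holds s (if (ratom q b j).1 then W * i + (ratom q b j).2 else (ratom q b j).2)
  = holds s ((i + q) * W + (b * g + j)).
Proof. by rewrite /= mulnC addnA -mulnDl. Qed.

Lemma prop_form_slot_eq b b' : prop_form (slot_eq b b').
Proof. by rewrite prop_form_all all_map; apply/allP. Qed.

Lemma sem_slot_eq s i b b' :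
  sem s (place i (slot_eq b b')) = (slot s b i.+1 == slot s b' i.+1).
Proof.
rewrite sem_place ?prop_form_slot_eq // peval_all all_map.
rewrite (eq_all (a2 := fun j => holds s (i.+1 * W + (b * g + j))
                                == holds s (i.+1 * W + (b' * g + j)))); last first.
  by move=> j; rewrite [LHS]peval_iff -[i.+1]addn1 -!holds_ratom.
apply/allP/eqP => [h|h j]; first by apply/eq_in_map => j /h /eqP.
by rewrite mem_iota /= => hj; rewrite -!nth_slot // h.
Qed.

Lemma sem_all_slots s f :
  sem s (all_slots f) = all (fun i => sem s (place i f)) (iota 0 m).
Proof. by rewrite sem_fAll all_map. Qed.

Lemma sem_all_eq s b b' c c' :
  sem s (all_slots (And (slot_eq b b') (slot_eq c c')))
  = (conf s b == conf s b') && (conf s c == conf s c').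
Proof.
have E a a' : (conf s a == conf s a')
    = all (fun i => slot s a i.+1 == slot s a' i.+1) (iota 0 m).
  apply/eqP/allP => [e p|h]; last by apply/eq_in_map => p /h /eqP.
  rewrite mem_iota /= => hp.
  by rewrite -!(nth_conf [::]) // e.
rewrite sem_all_slots !E -all_predI; apply: eq_all => i /=.
by rewrite -!sem_slot_eq.
Qed.

(** * One step of a cellular automaton as a formula *)

Definition zero_sym : seq bool := nseq g false.

Variable rho : seq bool -> seq bool -> seq bool -> seq bool -> seq bool.
Hypothesis size_rho : forall h l x r, size (rho h l x r) = g.

(** Besides its neighbours each cell consults cell 0, which will carry the state and the scanned
    symbols. *)
Definition ca_step (x : seq (seq bool)) : seq (seq bool) :=
  [seq rho (nth zero_sym x 0) (nth zero_sym (zero_sym :: x) i)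
           (nth zero_sym x i) (nth zero_sym x i.+1) | i <- iota 0 m].

Lemma shaped_ca_step x : shaped (ca_step x).
Proof.
rewrite /shaped size_map size_iota eqxx all_map; apply/allP => i _ /=.
by rewrite size_rho.
Qed.

Definition rho_bit (j : nat) (bs : seq bool) : bool :=
  nth false (rho (take g bs) (take g (drop g bs)) (take g (drop (2 * g) bs))
                 (take g (drop (3 * g) bs))) j.

(** Four groups of [g] bits, in the order in which [rho_bit] cuts them. The first group is absolute:
    slot 1 contains cell 0. *)
Definition rho_atoms : seq (bool * nat) :=
  [seq (false, W + (bX * g + j)) | j <- iota 0 g]
  ++ [seq ratom 0 bX j | j <- iota 0 g] ++ [seq ratom 1 bX j | j <- iota 0 g]
  ++ [seq ratom 2 bX j | j <- iota 0 g].

Definition step_form : form 'I_3 nat :=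
  all_slots (fAll [seq fIff (Atom (ratom 1 bY j)) (truth_table _ rho_atoms (rho_bit j))
                  | j <- iota 0 g]).

Lemma border_slot s b p :
  border_false s -> b < 5 -> (p == 0) || (p == m.+1) -> slot s b p = zero_sym.
Proof.
move=> bs hb hp; apply: (@eq_from_nth _ false); rewrite size_slot ?size_nseq // => j hj.
rewrite nth_slot // nth_nseq hj bs //.
  by apply: idx_lt => //; case/orP: hp => /eqP ->.
case/orP: hp => /eqP ->; first by rewrite mul0n add0n width_bound.
by rewrite leq_addr orbT.
Qed.

(** The false border slots supply the [zero_sym] that [ca_step] reads beyond either end, so one
    relative formula serves all cells. *)
Lemma sem_step s :
  border_false s -> sem s step_form = (ca_step (conf s bX) == conf s bY).
Proof.
move=> bs; rewrite sem_all_slots.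
have cellE p : nth zero_sym (zero_sym :: conf s bX) p =
    if p <= m then slot s bX p else zero_sym.
  case: p => [|p] /=; first by rewrite border_slot.
  by case: ltnP => hp; [rewrite nth_conf|rewrite nth_default ?size_conf].
have cellE' p : p <= m -> nth zero_sym (conf s bX) p = slot s bX p.+1.
  move=> hp; rewrite -[LHS]/(nth zero_sym (zero_sym :: conf s bX) p.+1) cellE.
  case: ifP => // hp'; rewrite border_slot //.
  by apply/orP; right; apply/eqP; lia.
have placeE i : i < m -> sem s (place i (fAll [seq fIff (Atom (ratom 1 bY j))
      (truth_table _ rho_atoms (rho_bit j)) | j <- iota 0 g]))
    = (nth [::] (ca_step (conf s bX)) i == slot s bY i.+1).
  move=> hi; rewrite sem_place; last first.
    rewrite prop_form_all all_map; apply/allP => j _.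
    by rewrite /= !prop_form_truth_table.
  rewrite (nth_map 0) ?size_iota // nth_iota // add0n !cellE'; [|lia|lia|lia].
  rewrite cellE (ltnW hi); set y := rho _ _ _ _.
  have R j : j < g -> peval (fun x => holds s (if x.1 then W * i + x.2 else x.2))
      (truth_table _ rho_atoms (rho_bit j)) = nth false y j.
    move=> hj; rewrite peval_truth_table /rho_atoms !map_cat -!map_comp /rho_bit.
    rewrite (eq_map (g := fun j => holds s (1 * W + (bX * g + j)))); last first.
      by move=> k /=; rewrite mul1n.
    have rE q : [seq ((fun x : bool * nat => holds s (if x.1 then W * i + x.2 else x.2))
        \o ratom q bX) k | k <- iota 0 g] = slot s bX (i + q).
      by apply: eq_map => k /=; rewrite -holds_ratom.
    rewrite !rE -/(slot s bX 1) addn0 addn1 addn2.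
    have tk (a r : seq bool) : size a = g -> take g (a ++ r) = a.
      by move=> <-; rewrite take_size_cat.
    have dp (a r : seq bool) k : size a = g -> drop (g + k) (a ++ r) = drop k r.
      by move=> <-; rewrite drop_cat ltnNge leq_addr addKn.
    (* Nested sums [g + _] let [dp] peel off one slot at a time. *)
    have e1 : g = g + 0 by rewrite addn0.
    have e2 : 2 * g = g + (g + 0) by lia.
    have e3 : 3 * g = g + (g + (g + 0)) by lia.
    rewrite e2 e3 [X in drop X]e1 !dp ?size_slot // !drop0 !tk ?size_slot //.
    by rewrite take_oversize ?size_slot.
  rewrite peval_all all_map.
  rewrite (eq_in_all (a2 := fun j => holds s (i.+1 * W + (bY * g + j))
                                     == nth false y j)); last first.
    move=> j; rewrite mem_iota => hj.
    by rewrite [LHS]peval_iff R // -[i.+1]addn1 -holds_ratom.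
  apply/allP/eqP => [h|h j].
    apply: (@eq_from_nth _ false); rewrite ?size_rho ?size_slot // => j hj.
    by rewrite nth_slot //; apply/esym/eqP/h; rewrite mem_iota.
  by rewrite mem_iota /= => hj; rewrite h nth_slot.
apply/allP/eqP => [h|h i].
  apply: (@eq_from_nth _ [::]); rewrite size_map ?size_iota ?size_conf // => i hi.
  by rewrite nth_conf //; apply/eqP; rewrite -placeE // h // mem_iota.
by rewrite mem_iota /= => hi; rewrite placeE // h nth_conf.
Qed.

(** * The reachability formula *)

Definition agent (a : nat) : 'I_3 := inord a.

Definition split_form : form 'I_3 nat :=
  fOr (all_slots (And (slot_eq bA bX) (slot_eq bB bZ)))
      (all_slots (And (slot_eq bA bZ) (slot_eq bB bY))).

Definition copy_form : form 'I_3 nat :=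
  all_slots (And (slot_eq bX bA) (slot_eq bY bB)).

(* Savitch's recursion: a midpoint [Z] is chosen, then one of the two halves is
   copied to [A], [B] and back to [X], [Y], so that the recursive call occurs
   once and the formula grows linearly with the level. *)
Fixpoint reach_form (k : nat) : form 'I_3 nat :=
  if k is k.+1 then
    Neg (K (agent 0) (Neg (K (agent 1) (Neg (And split_form
      (Neg (K (agent 2) (Neg (And copy_form (Neg (reach_form k)))))))))))
  else step_form.

Lemma reach_formS k : reach_form k.+1 =
  Neg (K (agent 0) (Neg (K (agent 1) (Neg (And split_form
    (Neg (K (agent 2) (Neg (And copy_form (Neg (reach_form k))))))))))).
Proof. by []. Qed.

(** Agent 2 guarded by [copy_form] acts as a substitution of [A], [B] for [X], [Y]; agent 1 guarded
    by [split_form] is a conjunction over the two halves; the negated [K] of agent 0 asserts a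
    midpoint. The state is generalized because the recursive call is evaluated after [X] and [Y]
    have been overwritten. *)
Lemma sem_reach s k :
  border_false s ->
  sem s (reach_form k) = (iter (2 ^ k) ca_step (conf s bX) == conf s bY).
Proof.
elim: k s => [|k IH] s bs; first exact: sem_step.
have h0 b : hides (agent 0) b = (b == bZ) by rewrite /hides inordK // inE.
have h1 b : hides (agent 1) b = (b == bA) || (b == bB) by rewrite /hides inordK // !inE.
have h2 b : hides (agent 2) b = (b == bX) || (b == bY) by rewrite /hides inordK // !inE.
set F := iter (2 ^ k) ca_step.
have copyE t : border_false t ->
    sem t (K (agent 2) (Neg (And copy_form (Neg (reach_form k)))))
    = (F (conf t bA) == conf t bB).
  move=> bt; rewrite /=; apply/forallP/idP => [h|/eqP h u].
    pose u := update (update t bX (conf t bA)) bY (conf t bB).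
    have a1 : t :&: observes (agent 2)
        == update t bX (conf t bA) :&: observes (agent 2).
      by apply: update_agree; rewrite h2.
    have a2 : t :&: observes (agent 2) == u :&: observes (agent 2).
      by rewrite (eqP a1) update_agree // h2.
    have bu := border_false_agree bt a2.
    have uX : conf u bX = conf t bA.
      by rewrite conf_update_other // conf_update // shaped_conf.
    have uY : conf u bY = conf t bB by rewrite conf_update // shaped_conf.
    have uA : conf u bA = conf t bA by rewrite !conf_update_other.
    have uB : conf u bB = conf t bB by rewrite !conf_update_other.
    have := h u; rewrite a2 /= sem_all_eq uX uY uA uB !eqxx /= negbK IH //.
    by rewrite uX uY.
  apply/implyP => a; rewrite sem_all_eq.
  rewrite (conf_agree (b := bA) _ _ a) ?h2 // (conf_agree (b := bB) _ _ a) ?h2 //.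
  apply/negP => /andP[/andP[/eqP eX /eqP eY]].
  by rewrite IH ?eX ?eY -/F ?h ?eqxx //; apply: border_false_agree bt a.
have splitE t : border_false t ->
    sem t (K (agent 1) (Neg (And split_form
      (Neg (K (agent 2) (Neg (And copy_form (Neg (reach_form k)))))))))
    = (F (conf t bX) == conf t bZ) && (F (conf t bZ) == conf t bY).
  move=> bt; have H u : sem u (Neg (And split_form
      (Neg (K (agent 2) (Neg (And copy_form (Neg (reach_form k))))))))
    = ~~ (sem u split_form && ~~ sem u (K (agent 2)
          (Neg (And copy_form (Neg (reach_form k)))))) by [].
  have SE u : sem u split_form
      = (conf u bA == conf u bX) && (conf u bB == conf u bZ)
        || (conf u bA == conf u bZ) && (conf u bB == conf u bY).
    by rewrite -!sem_all_eq /= -negb_or negbK.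
  rewrite sem_K.
  apply/forallP/andP => [h|[/eqP e1 /eqP e2] u].
    have get a b : (a == bX) && (b == bZ) || (a == bZ) && (b == bY) ->
        F (conf t a) == conf t b.
      move=> hab.
      have [ha5 hb5 naA naB /andP[nbA nbB]] :
          [/\ a < 5, b < 5, a != bA, a != bB & (b != bA) && (b != bB)].
        by case/orP: hab => /andP[/eqP-> /eqP->].
      pose u := update (update t bA (conf t a)) bB (conf t b).
      have a1 : t :&: observes (agent 1)
          == update t bA (conf t a) :&: observes (agent 1).
        by apply: update_agree; rewrite h1.
      have a2 : t :&: observes (agent 1) == u :&: observes (agent 1).
        by rewrite (eqP a1) update_agree // h1.
      have bu := border_false_agree bt a2.
      have uA : conf u bA = conf t a.
        by rewrite conf_update_other // conf_update // shaped_conf.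
      have uB : conf u bB = conf t b by rewrite conf_update // shaped_conf.
      have uO c : c < 5 -> c != bA -> c != bB -> conf u c = conf t c.
        by move=> *; rewrite !conf_update_other.
      have := h u; rewrite a2 implyTb H SE copyE // uA uB !uO //.
      by case/orP: hab => /andP[/eqP-> /eqP->]; rewrite !eqxx ?orbT /= negbK.
    by split; apply: get; rewrite !eqxx ?orbT.
  apply/implyP => a; rewrite H SE copyE; last exact: border_false_agree bt a.
  rewrite (conf_agree (b := bX) _ _ a) ?h1 // (conf_agree (b := bY) _ _ a) ?h1 //.
  rewrite (conf_agree (b := bZ) _ _ a) ?h1 //; apply/negP.
  case/andP => /orP[] /andP[/eqP-> /eqP->]; first by rewrite e1 eqxx.
  by rewrite e2 eqxx.
rewrite reach_formS sem_Neg sem_K expnS mul2n -addnn iterD -/F.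
apply/forallPn/eqP => [[u]|e].
  rewrite negb_imply sem_Neg negbK => /andP[a].
  rewrite splitE; last exact: border_false_agree bs a.
  rewrite !(conf_agree (b := bX) _ _ a) ?h0 // !(conf_agree (b := bY) _ _ a) ?h0 //.
  by case/andP => /eqP-> /eqP->.
(* The automaton is deterministic, so the midpoint is forced. *)
pose u := update s bZ (F (conf s bX)).
have a : s :&: observes (agent 0) == u :&: observes (agent 0).
  by apply: update_agree; rewrite h0.
exists u; rewrite negb_imply sem_Neg negbK a splitE; last exact: border_false_agree bs a.
have sF : shaped (F (conf s bX)).
  rewrite /F; case: (2 ^ k) => [|i]; first exact: shaped_conf.
  by rewrite iterS shaped_ca_step.
by rewrite /u conf_update // !conf_update_other // e !eqxx.
Qed.

(** * Initial and accepting configurations, and the query *)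

Definition slot_is (y : seq bool) : rform :=
  fAll [seq (if nth false y j then Atom (ratom 1 bX j) else Neg (Atom (ratom 1 bX j)))
       | j <- iota 0 g].

Definition init_form (y : nat -> seq bool) : form 'I_3 nat :=
  fAll [seq place i (slot_is (y i)) | i <- iota 0 m].

Lemma sem_init s y : (forall i, size (y i) = g) ->
  sem s (init_form y) = (conf s bX == [seq y i | i <- iota 0 m]).
Proof.
move=> sy; rewrite sem_fAll all_map.
have E i : sem s (place i (slot_is (y i))) = (slot s bX i.+1 == y i).
  rewrite sem_place; last first.
    rewrite prop_form_all all_map; apply/allP => j _ /=.
    by case: (nth _ _ _).
  rewrite peval_all all_map.
  have P j : peval (fun x => holds s (if x.1 then W * i + x.2 else x.2))
      (if nth false (y i) j then Atom (ratom 1 bX j)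
       else Neg (Atom (ratom 1 bX j)) : rform)
      = (holds s (i.+1 * W + (bX * g + j)) == nth false (y i) j).
    rewrite -[i.+1]addn1 -holds_ratom.
    by case: (nth _ _ _); rewrite /peval; case: (holds _ _).
  apply/allP/eqP => [h|h j].
    apply: (@eq_from_nth _ false); rewrite size_slot ?sy // => j hj.
    by rewrite nth_slot //; apply/eqP; rewrite -P; apply: h; rewrite mem_iota.
  by rewrite mem_iota /= P => hj; rewrite -h nth_slot.
apply/allP/eqP => [h|/eqP h i]; first by apply/eq_in_map => i /h; rewrite /= E => /eqP.
rewrite mem_iota /= => hi; rewrite E -(nth_conf [::]) // (eqP h).
by rewrite (nth_map 0) ?size_iota // nth_iota.
Qed.

Definition accept_form (R : seq bool -> bool) : form 'I_3 nat :=
  truth_table _ [seq W + (bY * g + j) | j <- iota 0 g] R.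

Lemma sem_accept s R : 0 < m ->
  sem s (accept_form R) = R (nth zero_sym (conf s bY) 0).
Proof.
move=> m0; rewrite sem_prop ?prop_form_truth_table // peval_truth_table -map_comp.
rewrite nth_conf //; congr R; apply: eq_map => j /=.
by rewrite mul1n.
Qed.

Definition query_form (y : nat -> seq bool) (R : seq bool -> bool) k : form 'I_3 nat :=
  Neg (K (agent 2) (Neg (And (init_form y) (And (accept_form R) (reach_form k))))).

(** Agent 2 guesses [X] and [Y], but [init_form] determines [X] and [reach_form] then determines
    [Y], so the acceptance test applies to the iterate itself. The empty state provides the false
    border. *)
Lemma sem_query y R k : 0 < m -> (forall i, size (y i) = g) ->
  sem set0 (query_form y R k)
  = R (nth zero_sym (iter (2 ^ k) ca_step [seq y i | i <- iota 0 m]) 0).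
Proof.
move=> m0 sy.
have h2 b : hides (agent 2) b = (b == bX) || (b == bY) by rewrite /hides inordK // !inE.
have b0 : border_false set0 by move=> x _ _; rewrite /holds inE.
set c := [seq y i | i <- iota 0 m].
rewrite sem_Neg sem_K.
have SE u : sem u (And (init_form y) (And (accept_form R) (reach_form k)))
  = sem u (init_form y) && (sem u (accept_form R) && sem u (reach_form k)) by [].
apply/forallPn/idP => [[u]|h].
  rewrite negb_imply sem_Neg negbK SE => /andP[a].
  rewrite sem_init // sem_accept // sem_reach; last exact: border_false_agree b0 a.
  by case/and3P => /eqP-> h /eqP->.
have sc : shaped c.
  by rewrite /shaped size_map size_iota eqxx all_map; apply/allP => i _ /=; rewrite sy.
have sF : shaped (iter (2 ^ k) ca_step c).
  by case: (2 ^ k) => [|i] //; rewrite iterS shaped_ca_step.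
pose u := update (update set0 bX c) bY (iter (2 ^ k) ca_step c).
have a1 : set0 :&: observes (agent 2) == update set0 bX c :&: observes (agent 2).
  by apply: update_agree; rewrite h2.
have a2 : set0 :&: observes (agent 2) == u :&: observes (agent 2).
  by rewrite (eqP a1) update_agree // h2.
have uX : conf u bX = c by rewrite conf_update_other // conf_update.
have uY : conf u bY = iter (2 ^ k) ca_step c by rewrite conf_update.
exists u; rewrite negb_imply sem_Neg negbK a2 SE sem_init // sem_accept // sem_reach.
  by rewrite uX uY !eqxx h.
exact: border_false_agree b0 a2.
Qed.

End Blocks.

(** * Machines as cellular automata *)

Section OneHot.
Variable G : finType.

(** Under this coding the all-false word codes no symbol, so the border decodes to [None]. *)
Definition onehot (x : G) : seq bool := [seq x == y | y <- enum G].

Definition unhot (bs : seq bool) : option G := onth (enum G) (index true bs).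

Lemma size_onehot x : size (onehot x) = #|G|.
Proof. by rewrite size_map -cardE. Qed.

Lemma onehotK : pcancel onehot unhot.
Proof.
move=> x; have xG : x \in enum G by rewrite mem_enum.
rewrite /unhot /onehot; elim: (enum G) xG => //= y s IH.
by rewrite inE; case: eqP => [->|] //= _ /IH.
Qed.

Lemma unhot_zero : unhot (zero_sym #|G|) = None.
Proof.
rewrite /unhot /zero_sym onth_default // cardE.
by elim: (size _) => //= n IH; rewrite ltnS.
Qed.

End OneHot.

Section Simulation.
Variable M : machine.
Local Notation tape_index := 'I_(extra_tapes M).+1.
Local Notation mcell := (cell (aux_sym M)).

(* Cell [i] of the automaton records whether [i = 0], the state, and, for each
   tape, entry [i] of the part left of the head and of the part starting at the
   head. *)
Definition sym : finType :=
  (bool * mstate M * {ffun tape_index -> mcell * mcell})%type.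

Definition sym_of (c : config M) (i : nat) : sym :=
  (i == 0, cstate c,
   [ffun k => (nth None (lpart (ctape c k)) i,
               nth None (hcell (ctape c k) :: rpart (ctape c k)) i)]).

Definition left_of (y : option sym) k : mcell :=
  if y is Some (_, _, f) then (f k).1 else None.
Definition right_of (y : option sym) k : mcell :=
  if y is Some (_, _, f) then (f k).2 else None.
Definition first_of (y : option sym) : bool :=
  if y is Some (b, _, _) then b else false.

(** The head stays at index 0 and the tape shifts past it. On a move to the left the written symbol
    arrives at index 1 of the right part, recognized by [first_of l]; on a move to the right it
    arrives at index 0 of the left part. *)
Definition next_sym (q : mstate M) (heads : {ffun tape_index -> mcell})
    (l : option sym) (x : sym) (r : option sym) : sym :=
  let: (q', a) := delta q heads in
  let b := x.1.1 in
  (b, q', [ffun k => let: (c, d) := a k in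
    match d with
    | Stay => (left_of (Some x) k, if b then c else right_of (Some x) k)
    | MoveL => (left_of r k,
                if b then left_of (Some x) k
                else if first_of l then c else right_of l k)
    | MoveR => (if b then c else left_of l k, right_of r k)
    end]).

Definition sim_rule (h l x r : seq bool) : seq bool :=
  if (unhot sym h, unhot sym x) is (Some (_, q, f), Some y) then
    onehot (if halting q then y
            else next_sym q [ffun k => (f k).2] (unhot sym l) y (unhot sym r))
  else zero_sym #|sym|.

Lemma size_sim_rule h l x r : size (sim_rule h l x r) = #|sym|.
Proof.
rewrite /sim_rule; case: (unhot _ h) => [[[_ q] f]|]; last by rewrite size_nseq.
by case: (unhot _ x) => [y|]; rewrite ?size_nseq ?size_onehot.
Qed.

Definition conf_of (m : nat) (c : config M) : seq (seq bool) :=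
  [seq onehot (sym_of c i) | i <- iota 0 m].

Lemma next_symE (c : config M) i :
  ~~ halting (cstate c) ->
  next_sym (cstate c) [ffun k => hcell (ctape c k)]
    (if i is j.+1 then Some (sym_of c j) else None) (sym_of c i)
    (Some (sym_of c i.+1))
  = sym_of (step c) i.
Proof.
move=> nh; rewrite /next_sym /sym_of /step (negbTE nh).
case: (delta _ _) => q' a /=; congr (_, _, _); apply/ffunP => k; rewrite !ffunE.
case: (a k) => [d []] /=; case: i => [|[|i]] //=; rewrite ?ffunE //=;
  case: (ctape c k) => [[|x l] h [|y r]] //=; rewrite ?nth_nil //.
Qed.

(** Only the last cell needs the size bounds: its right neighbour is the border, which decodes to
    [None] and reads as blank, and the bounds make the entries cut off there blank as well. *)
Lemma ca_step_conf_of m (c : config M) :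
  0 < m -> (forall k, size (lpart (ctape c k)) <= m /\ size (rpart (ctape c k)) < m) ->
  ca_step #|sym| m sim_rule (conf_of m c) = conf_of m (step c).
Proof.
move=> m0 hs; apply/eq_in_map => i; rewrite mem_iota add0n /= => hi.
have cE j : nth (zero_sym #|sym|) (conf_of m c) j
    = if j < m then onehot (sym_of c j) else zero_sym #|sym|.
  case: ltnP => hj; last by rewrite nth_default // size_map size_iota.
  by rewrite (nth_map 0) ?size_iota // nth_iota.
rewrite !cE m0 hi.
have -> : nth (zero_sym #|sym|) (zero_sym #|sym| :: conf_of m c) i
    = if i is j.+1 then onehot (sym_of c j) else zero_sym #|sym|.
  by case: i hi => //= i hi; rewrite cE ltnW.
rewrite /sim_rule !onehotK [sym_of c 0]/sym_of.
case: ifP => hq; first by rewrite /step hq.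
rewrite -next_symE ?hq //; congr onehot.
have -> : [ffun k => ([ffun k => (nth None (lpart (ctape c k)) 0,
      nth None (hcell (ctape c k) :: rpart (ctape c k)) 0)] k).2]
    = [ffun k => hcell (ctape c k)] by apply/ffunP => k; rewrite !ffunE.
have -> : unhot sym (if i is j.+1 then onehot (sym_of c j) else zero_sym #|sym|)
    = if i is j.+1 then Some (sym_of c j) else None.
  by case: (i) => [|j]; rewrite ?unhot_zero ?onehotK.
case: ltnP => hi'; first by rewrite onehotK.
rewrite unhot_zero /next_sym; case: (delta _ _) => q a.
congr (_, _, _); apply/ffunP => k; rewrite !ffunE.
have [h1 h2] := hs k.
have e1 : left_of (Some (sym_of c i.+1)) k = None.
  by rewrite /= ffunE /= nth_default // (leq_trans h1 hi').
have e2 : right_of (Some (sym_of c i.+1)) k = None.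
  by rewrite /= ffunE /= nth_default // -ltnS (leq_trans h2 hi').
by case: (a k) => d []; rewrite ?e1 ?e2.
Qed.

Lemma space_tape (c : config M) m k : space c <= m ->
  size (lpart (ctape c k)) + size (rpart (ctape c k)) < m.
Proof.
rewrite /space (bigD1 k) //= /tape_cells size_cat size_rev /=; lia.
Qed.

Definition accepting_sym (bs : seq bool) : bool :=
  if unhot sym bs is Some (_, q, _) then accepting q else false.

Definition input_sym (first : bool) (b : option bool) : seq bool :=
  onehot ((first, start M,
    [ffun k => (None, if k == ord0 then omap inl b else None)]) : sym).

Lemma conf_of_init m w :
  conf_of m (init M w) = [seq input_sym (i == 0) (ohead (drop i w)) | i <- iota 0 m].
Proof.
apply: eq_map => i; congr (onehot (_, _, _)); apply/ffunP => k; rewrite !ffunE.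
case: ifP => _ /=; last by rewrite !nth_nil; case: i => //= i; rewrite nth_nil.
rewrite nth_nil; congr (_, _).
by case: w i => [|b w] [|i] //=; rewrite ?nth_nil //; elim: w i {b} => [|b w IH] [|i] /=.
Qed.

Lemma halting_run w t k :
  halting (cstate (run M t w)) -> run M (t + k) w = run M t w.
Proof.
move=> h; elim: k => [|k IH]; first by rewrite addn0.
by rewrite addnS /run iterS -/(run M _ w) IH /step h.
Qed.

(* Pigeonhole: two equal configurations among the first [2 ^ (#|sym| * m)] make
   the run periodic from then on. *)
Lemma halts_early m w :
  0 < m -> (forall t, space (run M t w) <= m) ->
  (exists t, halting (cstate (run M t w))) ->
  halting (cstate (run M (2 ^ (#|sym| * m)) w)).
Proof.
move=> m0 sp [t0 ht0].
set T := 2 ^ _.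
(* Encodings are compared rather than configurations: visited blanks may distinguish tapes that the
   encoding identifies, yet the encoding still determines the state and all later encodings. *)
pose x t := conf_of m (run M t w).
have xE t : x t = iter t (ca_step #|sym| m sim_rule) (x 0).
  elim: t => [|t IH] //; rewrite iterS -IH ca_step_conf_of // => k.
  by have := space_tape k (sp t); lia.
pose D := {ffun 'I_m -> {ffun 'I_#|sym| -> bool}}.
pose e (y : seq (seq bool)) : D :=
  [ffun i : 'I_m => [ffun j : 'I_#|sym| => nth false (nth [::] y i) j]].
have e_inj s t : e (x s) = e (x t) -> x s = x t.
  move=> E; apply: (@eq_from_nth _ [::]); rewrite ?size_map ?size_iota // => i hi.
  have sz u : size (nth [::] (x u) i) = #|sym|.
    by rewrite (nth_map 0) ?size_iota // size_onehot.
  apply: (@eq_from_nth _ false); rewrite ?sz // => j hj.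
  have := congr1 (fun d : D => d (Ordinal hi) (Ordinal hj)) E.
  by rewrite /= !ffunE.
have stateE s t : x s = x t -> cstate (run M s w) = cstate (run M t w).
  move=> E; have := congr1 (fun y => unhot sym (nth [::] y 0)) E.
  rewrite /= /x /conf_of !(nth_map 0) ?size_iota // nth_iota // !onehotK.
  by case.
have /injectivePn[i [j ne eij]] : ~~ injectiveb (fun i : 'I_T.+1 => e (x i)).
  apply/negP => /injectiveP /leq_card.
  by rewrite !card_ffun card_bool !card_ord -expnM ltnn.
wlog lt : i j ne eij / i < j.
  move=> H; case: (ltngtP i j) => [lt|lt|E]; first exact: H lt.
    by apply: H lt; rewrite 1?eq_sym.
  by case/eqP: ne; apply: val_inj.
have {eij}E := e_inj _ _ eij.
have periodic k : x (i + k) = x (i + k %% (j - i)).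
  have P a : x (j + a) = x (i + a).
    by rewrite addnC xE iterD -xE -E xE -iterD addnC -xE.
  rewrite {1}(divn_eq k (j - i)); elim: (k %/ _) => [|q IH]; first by rewrite mul0n.
  by rewrite -IH -[RHS]P mulSn -!addnA addnA subnKC // ltnW.
(* Reducing [t0] modulo the period brings the halting time below [j]. *)
have hk : halting (cstate (run M (i + t0 %% (j - i)) w)).
  by rewrite -(stateE _ _ (periodic t0)) addnC halting_run.
have le : i + t0 %% (j - i) <= T.
  have := ltn_pmod t0 (_ : 0 < j - i); rewrite subn_gt0 => /(_ lt).
  have := ltn_ord j; lia.
by rewrite -(subnKC le) halting_run.
Qed.

(** Halted configurations are fixed, so the one reached at the prescribed time is the one in which
    the run halted; its state is read off cell 0. *)
Lemma simulation_accepts m w (L : Prop) :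
  0 < m -> (forall t, space (run M t w) <= m) ->
  (exists t, halting (cstate (run M t w)) /\ (L <-> accepting (cstate (run M t w)))) ->
  L <-> accepting_sym (nth (zero_sym #|sym|)
    (iter (2 ^ (#|sym| * m)) (ca_step #|sym| m sim_rule)
       [seq input_sym (i == 0) (ohead (drop i w)) | i <- iota 0 m]) 0).
Proof.
move=> m0 sp [t [ht Lt]].
have hT := halts_early m0 sp (ex_intro _ t ht).
set T := 2 ^ _ in hT *.
have -> : iter T (ca_step #|sym| m sim_rule)
    [seq input_sym (i == 0) (ohead (drop i w)) | i <- iota 0 m] = conf_of m (run M T w).
  rewrite -conf_of_init; elim: T {hT} => [|T IH] //; rewrite iterS IH ca_step_conf_of //.
  by move=> k; have := space_tape k (sp T); lia.
rewrite (nth_map 0) ?size_iota // nth_iota // /accepting_sym onehotK /=.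
suff -> : run M T w = run M t w by [].
case: (leqP t T) => [|/ltnW] le; first by rewrite -(subnKC le) halting_run.
by rewrite -[in RHS](subnKC le) halting_run.
Qed.

End Simulation.

(** * Printing the instance *)

(** With the positive base [n + 1], powers are monotone in the exponent even at [n = 0], which gives
    sums and products without a separate constant term. *)
Lemma poly_boundedP (f : nat -> nat) :
  polynomially_bounded f <-> exists c d, forall n, f n <= c * n.+1 ^ d.
Proof.
split=> -[c [d h]].
  exists (2 * c), d => n; apply: leq_trans (h n) _.
  have h1 : n ^ d <= n.+1 ^ d by case: (d) => // e; rewrite leq_exp2r.
  have h2 : 0 < n.+1 ^ d by rewrite expn_gt0.
  by nia.
exists (c * 2 ^ d), d => n; apply: leq_trans (h n) _.
case: n => [|n]; first by rewrite exp1n muln1 (leq_trans _ (leq_addl _ _)) //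
    leq_pmulr // expn_gt0.
rewrite -mulnA -expnMn (leq_trans _ (leq_addr _ _)) // leq_mul2l; apply/orP; right.
by case: d {h} => // d; rewrite leq_exp2r //; lia.
Qed.

Lemma poly_bounded_le (f h : nat -> nat) :
  (forall n, f n <= h n) -> polynomially_bounded h -> polynomially_bounded f.
Proof.
by move=> le [c [d hh]]; exists c, d => n; apply: leq_trans (le n) (hh n).
Qed.

Lemma poly_bounded_const c : polynomially_bounded (fun=> c).
Proof. by exists c, 0 => n; rewrite leq_addl. Qed.

Lemma poly_bounded_id : polynomially_bounded (fun n => n).
Proof. by exists 1, 1 => n; rewrite expn1; lia. Qed.

Lemma poly_bounded_add (f h : nat -> nat) :
  polynomially_bounded f -> polynomially_bounded h ->
  polynomially_bounded (fun n => f n + h n).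
Proof.
move=> /poly_boundedP[c [d hf]] /poly_boundedP[c' [d' hh]]; apply/poly_boundedP.
exists (c + c'), (d + d') => n; rewrite mulnDl leq_add //.
  by apply: leq_trans (hf n) _; rewrite leq_mul2l leq_pexp2l ?leq_addr ?orbT.
by apply: leq_trans (hh n) _; rewrite leq_mul2l leq_pexp2l ?leq_addl ?orbT.
Qed.

Lemma poly_bounded_mul (f h : nat -> nat) :
  polynomially_bounded f -> polynomially_bounded h ->
  polynomially_bounded (fun n => f n * h n).
Proof.
move=> /poly_boundedP[c [d hf]] /poly_boundedP[c' [d' hh]]; apply/poly_boundedP.
exists (c * c'), (d + d') => n; rewrite expnD mulnACA.
exact: leq_mul.
Qed.

Lemma poly_bounded_exp (f : nat -> nat) d :
  polynomially_bounded f -> polynomially_bounded (fun n => f n ^ d).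
Proof.
move=> hf; elim: d => [|d IH]; first exact: (poly_bounded_const 1).
apply: (@poly_bounded_le _ (fun n => f n * f n ^ d)).
  by move=> n; rewrite expnS.
exact: poly_bounded_mul.
Qed.

Ltac poly_bound :=
  repeat first [ exact: poly_bounded_const | exact: poly_bounded_id | assumption
               | apply: poly_bounded_add | apply: poly_bounded_mul
               | apply: poly_bounded_exp ].

(** [f] may fail to be monotone, so its bounding polynomial is composed with [h] in its place. *)
Lemma poly_bounded_comp (f h : nat -> nat) :
  polynomially_bounded f -> polynomially_bounded h ->
  polynomially_bounded (fun n => f (h n)).
Proof.
move=> [c [d hf]] hh.
apply: (@poly_bounded_le _ (fun n => c * h n ^ d + c)) => [n|]; first exact: hf.
by poly_bound.
Qed.

(** * Programs that print codes *)

Definition unaries (s : seq nat) : seq bool := flatten [seq unary n | n <- s].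

Lemma unaries_cat s s' : unaries (s ++ s') = unaries s ++ unaries s'.
Proof. by rewrite /unaries map_cat flatten_cat. Qed.

Lemma unaries_flatten (ss : seq (seq nat)) :
  unaries (flatten ss) = flatten [seq unaries s | s <- ss].
Proof. by elim: ss => //= s ss IH; rewrite unaries_cat IH. Qed.

(* [e m] is emitted by the same program for all numbers [m] of slots. *)
Definition emits (p : frag7) (e : nat -> seq bool) : Prop :=
  exists T, polynomially_bounded T /\ forall m L n u o,
    runs_to p (Store [:: m; 0; 0; L; n] u o) (T m)
      (Store [:: m; 0; 0; L; n] u (o ++ e m)).

Lemma emits_nil : emits (pseq [::]) (fun=> [::]).
Proof.
exists (fun=> 1); split=> [|m L n u o]; first by poly_bound.
by rewrite cats0; apply: runs_to_nil.
Qed.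

Lemma emits_cons p ps e e' :
  emits p e -> emits (pseq ps) e' -> emits (pseq (p :: ps)) (fun m => e m ++ e' m).
Proof.
move=> [T [pT hp]] [T' [pT' hps]]; exists (fun m => T m + T' m).
split=> [|m L n u o]; first by poly_bound.
by rewrite catA; apply: runs_to_cons (hp _ _ _ _ _) (hps _ _ _ _ _).
Qed.

Lemma emits_eq p e e' : e =1 e' -> emits p e -> emits p e'.
Proof. by move=> ee [T [pT h]]; exists T; split=> // m L n u o; rewrite -ee. Qed.

Definition pconst (s : seq nat) : frag7 := pemits (unaries s).

Lemma emits_const s : emits (pconst s) (fun=> unaries s).
Proof.
exists (fun=> (size (unaries s)).+1); split=> [|m L n u o]; first by poly_bound.
exact: runs_to_emits.
Qed.

Definition pcount (a b : nat) : frag7 :=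
  pseq [:: pslots (pemits (nseq b true)) pskip; pconst [:: a]].

Lemma emits_count a b : emits (pcount a b) (fun m => unaries [:: a + b * m]).
Proof.
apply: (@emits_eq _ (fun m => nseq (b * m) true ++ unaries [:: a] ++ [::])).
  move=> m; rewrite /unaries /= !cats0 /unary -cats1 -cats1 catA -nseqD.
  by rewrite addnC.
apply: emits_cons; last by apply: emits_cons; [exact: emits_const|exact: emits_nil].
exists (fun m => m * (b.+1 + 8) + 1 + 3); split=> [|m L n u o]; first by poly_bound.
have -> : nseq (b * m) true = flatten [seq nseq b true | _ <- iota 0 m] ++ [::].
  by rewrite cats0; elim: m 0 => [|m IH] i /=; rewrite ?muln0 // -IH -nseqD mulnS.
apply: (@runs_to_slots _ _ m (fun=> L) n (fun=> u) (fun=> nseq b true)) => [j o' _|o'].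
  by have := runs_to_emits (nseq b true) [:: m - j.+1; j; 0; L; n] u o'; rewrite size_nseq.
by rewrite cats0; apply: runs_to_skip.
Qed.

Definition token_value W i (x : bool * nat) : nat := if x.1 then W * i + x.2 else x.2.

(** In unary, adding the offset of the slot amounts to printing it in front of the number. *)
Definition template (xs : seq (bool * nat)) : seq (option bool) :=
  flatten [seq (if x.1 then [:: None] else [::]) ++ [seq Some b | b <- unary x.2]
          | x <- xs].

Lemma fill_template W i xs :
  flatten [seq fill W i x | x <- template xs]
  = unaries [seq token_value W i x | x <- xs].
Proof.
have some s : flatten [seq fill W i x | x <- [seq Some b | b <- s]] = s.
  by elim: s => //= b s ->.
elim: xs => //= -[r o] xs IH; rewrite /template /= !map_cat !flatten_cat some.
rewrite -/(template xs) IH /unaries /=; congr (_ ++ _).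
by case: r; rewrite //= cats0 /unary /token_value /= -!cats1 catA nseqD.
Qed.

Definition pslot_tokens W (xs post : seq (bool * nat)) : frag7 :=
  pslots (ptemplate W (template xs)) (ptemplate W (template post)).

Lemma emits_slot_tokens W xs post :
  emits (pslot_tokens W xs post) (fun m =>
    flatten [seq unaries [seq token_value W i x | x <- xs] | i <- iota 0 m]
    ++ unaries [seq token_value W m x | x <- post]).
Proof.
pose T k m := size (template k) * (m * (W + 9) + 3) + 1.
exists (fun m => m * (T xs m + 8) + T post m + 3); split=> [|m L n u o].
  by poly_bound.
apply: (@runs_to_slots _ _ m (fun=> L) n (fun=> u)
  (fun i => unaries [seq token_value W i x | x <- xs])) => [j o' lt|o'].
  rewrite -fill_template; refine (runs_to_le (runs_to_template _ _ _ _ _ _ _ _) _).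
  by rewrite /T leq_add2r leq_mul2l leq_add2r leq_mul2r (ltnW lt) !orbT.
by rewrite -fill_template; apply: runs_to_template.
Qed.

Fixpoint code_nat (f : form 'I_3 nat) : seq nat :=
  match f with
  | Top => [:: 0]
  | Bot => [:: 1]
  | Atom p => [:: 2; p]
  | Neg g => 3 :: code_nat g
  | And g h => 4 :: code_nat g ++ code_nat h
  | K i g => [:: 5, val i & code_nat g]
  end.

Fixpoint code_rel (f : rform) : seq (bool * nat) :=
  match f with
  | Top => [:: (false, 0)]
  | Bot => [:: (false, 1)]
  | Atom p => [:: (false, 2); p]
  | Neg g => (false, 3) :: code_rel g
  | And g h => (false, 4) :: code_rel g ++ code_rel h
  | K i g => [:: (false, 5), (false, val i) & code_rel g]
  end.

Lemma code_nat_place g i f :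
  code_nat (place g i f) = [seq token_value (width g) i x | x <- code_rel f].
Proof.
rewrite /place; elim: f => //= [f ->|f -> h ->|a f ->] //.
by rewrite map_cat.
Qed.

(** In prefix notation a right-nested conjunction is a row of independent words followed by the code
    of [Top]: a loop can print it. *)
Lemma code_nat_all fs :
  code_nat (fAll fs) = flatten [seq 4 :: code_nat f | f <- fs] ++ [:: 0].
Proof. by elim: fs => //= f fs ->; rewrite catA. Qed.

Definition pall g (f : rform) : frag7 :=
  pseq [:: pslot_tokens (width g) ((false, 4) :: code_rel f) [::]; pconst [:: 0]].

Lemma emits_all g f : emits (pall g f) (fun m => unaries (code_nat (all_slots g m f))).
Proof.
apply: emits_eq (emits_cons (emits_slot_tokens _ _ _)
  (emits_cons (emits_const _) emits_nil)) => m.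
rewrite /all_slots code_nat_all unaries_cat unaries_flatten -!map_comp /= !cats0.
congr (flatten _ ++ _); apply: eq_map => i /=.
by rewrite code_nat_place.
Qed.

Section Generator.
Variables (g : nat) (rho : seq bool -> seq bool -> seq bool -> seq bool -> seq bool).
Variables (isym : bool -> option bool -> seq bool) (R : seq bool -> bool).
Local Notation W := (width g).

Definition pinit_slot (first : bool) (b : option bool) : frag7 :=
  ptemplate W (template ((false, 4) :: code_rel (slot_is g (isym first b)))).

Definition pinit : frag7 :=
  pseq [:: pslots (pseq [:: pifz ri (pcase (pinit_slot true)) (pcase (pinit_slot false));
                            pnext]) pskip;
           pconst [:: 0]].

Lemma runs_to_init : exists T, polynomially_bounded T /\ forall m L n w o,
  runs_to pinit (Store [:: m; 0; 0; L; n] w o) (T m)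
    (Store [:: m; 0; 0; L; n] (drop m w)
      (o ++ unaries (code_nat (init_form g m
              (fun i => isym (i == 0) (ohead (drop i w))))))).
Proof.
(* A pass prints one of six templates, according to whether the slot is the first and whether the
   input there is 1, 0 or exhausted. *)
pose S := \max_(x : bool * option bool)
  size (template ((false, 4) :: code_rel (slot_is g (isym x.1 x.2)))).
pose T m := S * (m * (W + 9) + 3) + 1 + 5.
exists (fun m => (m * (T m + 8) + 1 + 3) + ((size (unaries [:: 0])).+1 + 1)).
split=> [|m L n w o]; first by poly_bound.
pose e i := unaries (4 :: code_nat (place g i
  (slot_is g (isym (i == 0) (ohead (drop i w)))))).
have -> : unaries (code_nat (init_form g m (fun i => isym (i == 0) (ohead (drop i w)))))
    = (flatten [seq e i | i <- iota 0 m] ++ [::]) ++ unaries [:: 0].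
  rewrite /init_form code_nat_all unaries_cat unaries_flatten -!map_comp cats0.
  by congr (flatten _ ++ _); apply: eq_map.
rewrite catA; apply: runs_to_cons; last first.
  by apply: runs_to_cons (runs_to_emits _ _ _ _) (runs_to_nil _).
have := @runs_to_slots (pseq [:: pifz ri (pcase (pinit_slot true))
  (pcase (pinit_slot false)); pnext]) pskip m (fun=> L) n (fun i => drop i w) e
  [::] (T m) 1 o; rewrite drop0; apply=> [j o' lt|o']; last first.
  by rewrite cats0; apply: runs_to_skip.
pose p := pinit_slot (j == 0) (ohead (drop j w)).
pose K0 := size (template ((false, 4) ::
  code_rel (slot_is g (isym (j == 0) (ohead (drop j w)))))).
have h : runs_to p (Store [:: m - j.+1; j; 0; L; n] (drop j w) o')
    (K0 * (j * (W + 9) + 3) + 1)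
    (Store [:: m - j.+1; j; 0; L; n] (drop j w) (o' ++ e j)).
  rewrite /e -[4 :: _]/[:: 4 & _] code_nat_place.
  have := @runs_to_template W (template ((false, 4) ::
    code_rel (slot_is g (isym (j == 0) (ohead (drop j w))))))
    (m - j.+1) j L n (drop j w) o'.
  by rewrite fill_template.
have h' : runs_to (pifz ri (pcase (pinit_slot true)) (pcase (pinit_slot false)))
    (Store [:: m - j.+1; j; 0; L; n] (drop j w) o')
    (K0 * (j * (W + 9) + 3) + 1).+3
    (Store [:: m - j.+1; j; 0; L; n] (drop j w) (o' ++ e j)).
  apply: runs_to_ifz; rewrite {1}/reg /=; move: h; rewrite /p.
  by case: (j == 0) => h; apply: runs_to_case.
have e1 : behead (drop j w) = drop j.+1 w by rewrite -drop1 drop_drop add1n.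
have h2 := runs_to_next [:: m - j.+1; j; 0; L; n] (drop j w) (o' ++ e j).
rewrite e1 in h2.
refine (runs_to_le (runs_to_cons h' (runs_to_cons h2 (runs_to_nil _))) _).
have le : K0 <= S by apply: (leq_bigmax (j == 0, ohead (drop j w))).
have : K0 * (j * (W + 9) + 3) <= S * (m * (W + 9) + 3).
  by rewrite leq_mul // leq_add2r leq_mul2r (ltnW lt) orbT.
by rewrite /T; lia.
Qed.

(** The literals are prefix code: 3 is [Neg], 4 is [And], and 5 with the next number is [K] of an
    agent. The ending 3, 4, 3 of the first word opens the disjunction in [split_form]. *)
Definition plevel : frag7 := pseq [::
  pconst [:: 3; 5; 0; 3; 5; 1; 3; 4; 3; 4; 3];
  pall g (And (slot_eq g bA bX) (slot_eq g bB bZ)); pconst [:: 3];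
  pall g (And (slot_eq g bA bZ) (slot_eq g bB bY)); pconst [:: 3; 5; 2; 3; 4];
  pall g (And (slot_eq g bX bA) (slot_eq g bY bB)); pconst [:: 3]].

(* The code of [reach_form k.+1] up to its recursive call. *)
Definition code_level m : seq nat :=
  [:: 3; 5; 0; 3; 5; 1; 3; 4] ++ code_nat (split_form g m)
  ++ [:: 3; 5; 2; 3; 4] ++ code_nat (copy_form g m) ++ [:: 3].

Lemma emits_level : emits plevel (fun m => unaries (code_level m)).
Proof.
have ce := emits_cons (emits_const _); have ca := emits_cons (emits_all _ _).
apply: emits_eq (ce _ _ _ (ca _ _ _ _ (ce _ _ _ (ca _ _ _ _ (ce _ _ _
  (ca _ _ _ _ (ce _ _ _ emits_nil))))))) => m.
by rewrite cats0 -!unaries_cat /code_level /split_form /copy_form /= -!catA.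
Qed.

Lemma code_reach m k :
  code_nat (reach_form g m rho k)
  = flatten (nseq k (code_level m)) ++ code_nat (step_form g m rho).
Proof.
elim: k => [|k IH] //; rewrite reach_formS /= IH /code_level /= !inordK //.
by rewrite -!catA /= -!catA.
Qed.

(** The loop over the slots loads [rL] with [g * m], the number of levels, which the second loop
    runs down. *)
Definition preach : frag7 := pseq [::
  pslots (pseq (nseq g (pinc rL))) pskip;
  pwhile rL (pseq [:: pdec rL; plevel]);
  pall g (fAll [seq fIff (Atom (ratom g 1 bY j))
                         (truth_table _ (rho_atoms g) (rho_bit g rho j)) | j <- iota 0 g])].

Lemma runs_to_reach : exists T, polynomially_bounded T /\ forall m n u o,
  runs_to preach (Store [:: m; 0; 0; 0; n] u o) (T m)
    (Store [:: m; 0; 0; 0; n] u (o ++ unaries (code_nat (reach_form g m rho (g * m))))).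
Proof.
have [T1 [pT1 h1]] := emits_level.
have [T2 [pT2 h2]] := emits_all g (fAll [seq fIff (Atom (ratom g 1 bY j))
  (truth_table _ (rho_atoms g) (rho_bit g rho j)) | j <- iota 0 g]).
exists (fun m => (m * (g.+1 + 8) + 1 + 3) + ((g * m * (T1 m + 3) + 1) + (T2 m + 1))).
split=> [|m n u o]; first by poly_bound.
rewrite code_reach unaries_cat catA.
have l1 : runs_to (pslots (pseq (nseq g (pinc rL))) pskip)
    (Store [:: m; 0; 0; 0; n] u o) (m * (g.+1 + 8) + 1 + 3)
    (Store [:: m; 0; 0; g * m; n] u o).
  have := @runs_to_slots (pseq (nseq g (pinc rL))) pskip m (fun j => g * j) n
    (fun=> u) (fun=> [::]) [::] g.+1 1 o.
  rewrite muln0 (_ : flatten _ ++ [::] = [::]); last by elim: (iota 0 m).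
  rewrite cats0; apply=> [j o' _|o']; last by rewrite cats0; apply: runs_to_skip.
  rewrite cats0 mulnSr; elim: (g) (g * j) => [|k IH] L.
    by rewrite addn0; apply: runs_to_nil.
  rewrite -addSnnS.
  exact: (runs_to_cons (runs_to_inc rL [:: m - j.+1; j; 0; L; n] u o') (IH _)).
pose s j := Store [:: m; 0; 0; g * m - j; n] u
  (o ++ unaries (flatten (nseq j (code_level m)))).
have l2 : runs_to (pwhile rL (pseq [:: pdec rL; plevel])) (s 0)
    (g * m * (T1 m + 2).+1 + 1) (s (g * m)).
  apply: runs_to_while => [j lt|]; last exact: subnn.
  split; first by rewrite /reg /= subn_gt0.
  have e : g * m - j = (g * m - j.+1).+1 by rewrite -subSn.
  have -> : s j.+1 = Store [:: m; 0; 0; g * m - j.+1; n] u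
      ((o ++ unaries (flatten (nseq j (code_level m)))) ++ unaries (code_level m)).
    rewrite /s -catA -unaries_cat; congr (Store _ _ (_ ++ unaries _)).
    by rewrite -[in LHS]addn1 nseqD flatten_cat /= cats0.
  rewrite /s e.
  have {}h1 := h1 m (g * m - j.+1) n u (o ++ unaries (flatten (nseq j (code_level m)))).
  by run; lia.
rewrite /s subn0 subnn cats0 in l2.
have {}h2 := h2 m 0 n u (o ++ unaries (flatten (nseq (g * m) (code_level m)))).
by run; lia.
Qed.

Definition pquery : frag7 := pseq [::
  pconst [:: 3; 5; 2; 3; 4]; pinit; pconst (4 :: code_nat (accept_form g R)); preach].

Definition pobs (a : 'I_3) : frag7 :=
  let v := [seq o <- iota 0 W | ~~ hides a (o %/ g)] in
  pseq [:: pcount (2 * W) (size v); pconst (iota 0 W);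
           pslot_tokens W [seq (true, W + o) | o <- v] [seq (true, W + o) | o <- iota 0 W]].

(** 3 is the number of agents; 1, 0, 1 are the size, the root and the single [true] terminal of the
    law; the final 0 is the empty actual state. *)
Definition pheader : frag7 := pseq [::
  pconst [:: 3]; pcount (2 * W).+1 W; pconst [:: 1; 0; 1];
  pobs (agent 0); pobs (agent 1); pobs (agent 2); pconst [:: 0]].

(** Sets of ordinals are enumerated increasingly, so the observables come slot by slot: a full
    border slot, the visible offsets [v] of each inner slot, and the other full border slot. The two
    borders account for [2 * W]. *)
Lemma code_observes m (a : 'I_3) : 0 < g ->
  let v := [seq o <- iota 0 W | ~~ hides a (o %/ g)] in
  code_set (observes g m a) = (2 * W + size v * m) :: iota 0 W
    ++ flatten [seq [seq W * i + (W + o) | o <- v] | i <- iota 0 m]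
    ++ [seq W * m + (W + o) | o <- iota 0 W].
Proof.
move=> g0 v.
have W0 : 0 < W by rewrite /width; lia.
have -> : code_set (observes g m a)
    = let l := [seq x <- iota 0 (last_atom g m).+1 | visible g m a x] in size l :: l.
  have E : [seq val x | x <- enum (observes g m a)]
      = [seq x <- iota 0 (last_atom g m).+1 | visible g m a x].
    rewrite -val_enum_ord filter_map; congr map; rewrite enumT /enum_mem.
    by apply: eq_filter => x; rewrite /= inE.
  by rewrite /code_set -E size_map -cardE.
have shift k : iota (W + W * k) W = [seq W * k + (W + o) | o <- iota 0 W].
  rewrite addnC -{1}[W * k + W]addn0 iotaDl; apply: eq_map => o.
  by rewrite addnA.
have inner k : k <= m ->
    [seq x <- iota W (W * k) | visible g m a x]
    = flatten [seq [seq W * i + (W + o) | o <- v] | i <- iota 0 k].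
  elim: k => [|k IH] le; first by rewrite muln0.
  rewrite mulnSr iotaD filter_cat (IH (ltnW le)) shift.
  rewrite -[in RHS]addn1 iotaD map_cat flatten_cat /= cats0 add0n; congr (_ ++ _).
  rewrite filter_map; congr map; apply: eq_in_filter => o.
  rewrite mem_iota /= => lt; have ex : W * k + (W + o) = k.+1 * W + o by lia.
  have le2 : k.+2 * W <= m.+1 * W by rewrite leq_mul2r ltnS le orbT.
  have le3 : W <= k.+1 * W by rewrite leq_pmull.
  rewrite /visible ex modnMDl modn_small // /last_atom.
  have -> : k.+1 * W + o < m.+2 * W by move: le2; rewrite !mulSn; lia.
  have -> : (k.+1 * W + o < W) = false by lia.
  by have -> : (m.+1 * W <= k.+1 * W + o) = false by move: le2; rewrite !mulSn; lia.
have -> : [seq x <- iota 0 (last_atom g m).+1 | visible g m a x]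
    = iota 0 W ++ flatten [seq [seq W * i + (W + o) | o <- v] | i <- iota 0 m]
      ++ [seq W * m + (W + o) | o <- iota 0 W].
  have -> : (last_atom g m).+1 = W + (W * m + (W + 1)) by rewrite /last_atom !mulSn; lia.
  rewrite (iotaD 0 W) (iotaD _ (W * m)) (iotaD _ W) !filter_cat !add0n.
  rewrite inner // -shift; congr (_ ++ (_ ++ _)).
    apply/all_filterP/allP => x; rewrite mem_iota /= /visible /last_atom => lt.
    by rewrite lt !mulSn; lia.
  rewrite [X in _ ++ X](_ : _ = [::]) ?cats0.
    apply/all_filterP/allP => x; rewrite mem_iota /= /visible /last_atom !mulSn.
    by case/andP => h1 h2; apply/andP; split; [|apply/orP; right; apply/orP; left]; lia.
  (* The top atom lies in no slot and no agent observes it. *)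
  have -> : W + W * m + W = last_atom g m by rewrite /last_atom !mulSn; lia.
  by rewrite /= /visible ltnn.
congr (_ :: _); rewrite !size_cat size_map !size_iota size_flatten /shape -map_comp.
rewrite (eq_map (g := fun=> size v)); last by move=> i /=; rewrite size_map.
have -> : sumn [seq size v | _ <- iota 0 m] = size v * m.
  by elim: (m) 0 => [|k IH] i /=; rewrite ?muln0 // IH mulnS.
by lia.
Qed.

Lemma emits_obs (a : 'I_3) : 0 < g ->
  emits (pobs a) (fun m => unaries (code_set (observes g m a))).
Proof.
move=> g0.
apply: emits_eq (emits_cons (emits_count _ _) (emits_cons (emits_const _)
  (emits_cons (emits_slot_tokens _ _ _) emits_nil))) => m.
rewrite code_observes // -[_ :: (_ ++ _)]cat1s !unaries_cat unaries_flatten -!map_comp cats0.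
by congr (_ ++ (_ ++ (flatten _ ++ _))); apply: eq_map => i /=; rewrite -map_comp.
Qed.

Definition code_header m : seq nat :=
  [:: 3; (last_atom g m).+1; 1; 0; 1]
  ++ code_set (observes g m (agent 0)) ++ code_set (observes g m (agent 1))
  ++ code_set (observes g m (agent 2)) ++ [:: 0].

Lemma emits_header : 0 < g -> emits pheader (fun m => unaries (code_header m)).
Proof.
move=> g0; have co a ps e := @emits_cons _ ps _ e (emits_obs a g0).
apply: emits_eq (emits_cons (emits_const _) (emits_cons (emits_count _ _)
  (emits_cons (emits_const _) (co _ _ _ (co _ _ _ (co _ _ _
  (emits_cons (emits_const _) emits_nil))))))) => m.
rewrite cats0 -!unaries_cat /code_header; congr unaries.
rewrite (_ : (2 * W).+1 + W * m = (last_atom g m).+1) //.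
by rewrite /last_atom !mulSn; lia.
Qed.

Definition input_at (w : seq bool) (i : nat) : seq bool :=
  isym (i == 0) (ohead (drop i w)).

Lemma runs_to_query : exists T, polynomially_bounded T /\ forall m n w o,
  runs_to pquery (Store [:: m; 0; 0; 0; n] w o) (T m)
    (Store [:: m; 0; 0; 0; n] (drop m w)
      (o ++ unaries (code_nat (query_form g m rho (input_at w) R (g * m))))).
Proof.
have [T1 [pT1 h1]] := runs_to_init; have [T2 [pT2 h2]] := runs_to_reach.
set s1 := [:: 3; 5; 2; 3; 4]; set s2 := 4 :: code_nat (accept_form g R).
exists (fun m => (size (unaries s1)).+1 + (T1 m + ((size (unaries s2)).+1 + (T2 m + 1)))).
split=> [|m n w o]; first by poly_bound.
have -> : code_nat (query_form g m rho (input_at w) R (g * m))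
    = s1 ++ code_nat (init_form g m (input_at w)) ++ s2
      ++ code_nat (reach_form g m rho (g * m)).
  by rewrite /= inordK.
rewrite !unaries_cat (catA o (unaries s1)).
rewrite (catA _ (unaries (code_nat (init_form _ _ _)))) (catA _ (unaries s2)).
exact: (runs_to_cons (runs_to_emits _ _ _ _) (runs_to_cons (h1 _ _ _ _ _)
  (runs_to_cons (runs_to_emits _ _ _ _) (runs_to_cons (h2 _ _ _ _) (runs_to_nil _))))).
Qed.

Definition slots_for (c d n : nat) : nat := c * n.+1 ^ d.

Definition reduction_word c d (w : seq bool) : seq bool :=
  let m := slots_for c d (size w) in
  unaries (code_header m ++ code_nat (query_form g m rho (input_at w) R (g * m))).

Lemma reduction_polytime c d : 0 < g -> polytime_computable (reduction_word c d).
Proof.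
move=> g0; have [T1 [pT1 h1]] := emits_header g0; have [T2 [pT2 h2]] := runs_to_query.
pose p := pseq [:: psize c d; pheader; pquery].
pose m n := slots_for c d n.
have pm : polynomially_bounded m.
  by apply/poly_boundedP; exists c, d.
pose T n := (c + d * (m n * (n * 13 + 10) + 3) + 1) + (T1 (m n) + (T2 (m n) + 1)).
apply: (@machine_of_computes p _ T) => [w|].
  exists [:: m (size w); 0; 0; 0; size w], (drop (m (size w)) w).
  rewrite /reduction_word unaries_cat.
  exact: (runs_to_cons (runs_to_size _ _ _ _ _) (runs_to_cons (h1 _ _ _ _ _)
    (runs_to_cons (h2 _ _ _ _) (runs_to_nil _)))).
have p1 := poly_bounded_comp pT1 pm; have p2 := poly_bounded_comp pT2 pm.
by poly_bound.
Qed.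

End Generator.

(** * The reduction *)

Fixpoint atoms_in A V (P : pred V) (f : form A V) : bool :=
  match f with
  | Top | Bot => true
  | Atom x => P x
  | Neg f => atoms_in P f
  | And f h => atoms_in P f && atoms_in P h
  | K _ f => atoms_in P f
  end.

(** [inord] collapses numbers out of range, so the range condition is what makes the printed numbers
    those of the instance. *)
Lemma code_fmap_inord N (f : form 'I_3 nat) :
  atoms_in (fun x => x < N.+1) f -> code_form (fmap (@inord N) f) = code_nat f.
Proof.
elim: f => //= [x h|f IH /IH->|f IHf h IHh /andP[/IHf-> /IHh->]|a f IH /IH->] //.
by rewrite inordK.
Qed.

Lemma atoms_in_all A V (P : pred V) (fs : seq (form A V)) :
  atoms_in P (fAll fs) = all (atoms_in P) fs.
Proof. by elim: fs => //= f fs ->. Qed.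

Lemma atoms_in_truth_table A V (P : pred V) vs R :
  all P vs -> atoms_in P (truth_table A vs R).
Proof.
elim: vs R => [|x vs IH] R /=; first by case: (R _).
by case/andP => -> h; rewrite !IH.
Qed.

Lemma atoms_in_fmap A V V' (h : V -> V') P (f : form A V) :
  atoms_in P (fmap h f) = atoms_in (P \o h) f.
Proof. by elim: f => //= f -> // f' ->. Qed.

Lemma sub_atoms_in A V (P Q : pred V) (f : form A V) :
  subpred P Q -> atoms_in P f -> atoms_in Q f.
Proof.
move=> PQ; elim: f => //= f IHf h IHh.
by case/andP => /IHf-> /IHh->.
Qed.

Section Bounds.
Variables (g m : nat) (m0 : 0 < m).
Local Notation W := (width g).
Local Notation in_range := (atoms_in (fun x => x < (last_atom g m).+1)).

(** A relative atom reaches slot [i + 2] at most and an absolute one slot 2; the last slot is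
    [m + 1]. *)
Lemma place_in_range i f : i < m ->
  atoms_in (fun x : bool * nat => x.2 < 3 * W) f -> in_range (place g i f).
Proof.
move=> hi; rewrite atoms_in_fmap; apply: sub_atoms_in => -[r o] /= ho.
have h : W * i.+1 <= W * m by rewrite leq_mul2l hi orbT.
rewrite mulnS in h; rewrite /last_atom !mulSn (mulnC m); case: r; lia.
Qed.

Lemma all_slots_in_range f :
  atoms_in (fun x : bool * nat => x.2 < 3 * W) f -> in_range (all_slots g m f).
Proof.
move=> h; rewrite atoms_in_all all_map; apply/allP => i; rewrite mem_iota => hi.
exact: place_in_range.
Qed.

Lemma ratom_lt q b j : q < 3 -> b < 5 -> j < g -> (ratom g q b j).2 < 3 * W.
Proof. by move=> hq hb hj; apply: idx_lt. Qed.

Lemma slot_eq_in_range b b' : b < 5 -> b' < 5 ->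
  atoms_in (fun x : bool * nat => x.2 < 3 * W) (slot_eq g b b').
Proof.
move=> hb hb'; rewrite atoms_in_all all_map; apply/allP => j; rewrite mem_iota => hj.
by rewrite /= -/(ratom g 1 b j) !(ratom_lt (q := 1)).
Qed.

Lemma reach_form_in_range rho k : in_range (reach_form g m rho k).
Proof.
elim: k => [|k IH].
  apply: all_slots_in_range; rewrite atoms_in_all all_map; apply/allP => j.
  rewrite mem_iota => hj.
  have h : all (fun x : bool * nat => x.2 < 3 * W) (rho_atoms g).
    rewrite /rho_atoms !all_cat !all_map -!all_predI; apply/allP => l.
    rewrite mem_iota => hl /=.
    have h q : q < 3 -> q * W + (bX * g + l) < 3 * W by move=> hq; apply: idx_lt.
    by rewrite -{1}[W]mul1n !h.
  by rewrite /= !atoms_in_truth_table // !andbT !(ratom_lt (q := 1)).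
have sl a b c d : a < 5 -> b < 5 -> c < 5 -> d < 5 ->
    in_range (all_slots g m (And (slot_eq g a b) (slot_eq g c d))).
  by move=> *; apply: all_slots_in_range; rewrite /= !slot_eq_in_range.
by rewrite reach_formS /= IH !sl.
Qed.

Lemma query_in_range rho y R k : in_range (query_form g m rho y R k).
Proof.
rewrite /= reach_form_in_range andbT; apply/andP; split.
  rewrite atoms_in_all all_map; apply/allP => i; rewrite mem_iota => hi.
  apply: place_in_range => //; rewrite atoms_in_all all_map; apply/allP => j.
  rewrite mem_iota => hj.
  by have := @ratom_lt 1 bX j isT isT hj; rewrite /=; case: (nth _ _ _).
apply: atoms_in_truth_table; rewrite all_map; apply/allP => j; rewrite mem_iota => hj.
rewrite /= -[X in X + _ < _]mul1n ltnS ltnW // /last_atom.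
by apply: idx_lt.
Qed.

End Bounds.

Section Instance.
Variables (g m : nat) (f : form 'I_3 nat).

Definition true_bdd (V : Type) : bdd V := @Bdd V 1 [ffun=> Terminal true] ord0.

Definition reduction_instance : instance :=
  @Instance 3 (last_atom g m).+1 (true_bdd _) [ffun a => observes g m a] set0
    (fmap (@inord (last_atom g m)) f).

Lemma true_bdd_eval (V : finType) (s : {set V}) : bdd_eval (true_bdd V) s.
Proof. by rewrite /bdd_eval ffunE. Qed.

Lemma reduction_instance_wf : well_formed reduction_instance.
Proof.
split; last exact: true_bdd_eval.
- by move=> x y v lo hi v' lo' hi'; rewrite ffunE.
- split=> [x y _|x v lo hi|x]; first by rewrite [x]ord1 [y]ord1.
    by rewrite ffunE.
  by rewrite [x]ord1 connect0.
Qed.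

Lemma reduction_instance_sat :
  sat (kstruct_of reduction_instance) (actual reduction_instance)
      (query reduction_instance) <-> sem (g := g) (m := m) set0 f.
Proof.
apply: rwP; apply: satP => [t|a]; first exact: true_bdd_eval.
by rewrite /= ffunE.
Qed.

Lemma encode_reduction_instance :
  atoms_in (fun x => x < (last_atom g m).+1) f ->
  encode reduction_instance = unaries (code_header g m ++ code_nat f).
Proof.
move=> h; rewrite /encode -/(unaries _); congr unaries.
rewrite /code_instance /= code_fmap_inord // /code_header.
have -> : enum 'I_3 = [:: agent 0; agent 1; agent 2].
  by apply: (inj_map val_inj); rewrite val_enum_ord /= !inordK.
have -> : enum 'I_1 = [:: ord0] by rewrite enum_ordSl /= (size0nil (size_enum_ord 0)).
by rewrite /= !ffunE cats0 enum_set0 cards0 -!catA /= -!catA /= -!catA.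
Qed.

End Instance.

Theorem theorem1 : PSPACE_hard model_checking_EL.
Proof.
move=> L [M [S [[c [d hS]] hM]]].
(* [c * n ^ d + c <= 2 * c * (n + 1) ^ d]; the successor keeps the number of slots positive when
   [c = 0]. *)
pose g := #|sym M|; pose C := (2 * c).+1.
pose slots (w : seq bool) := slots_for C d (size w).
have g0 : 0 < g.
  by apply/card_gt0P; exists (true, start M, [ffun=> (None, None)]).
pose q w := query_form g (slots w) (@sim_rule M)
  (input_at (@input_sym M) w) (@accepting_sym M) (g * slots w).
exists (reduction_word g (@sim_rule M) (@input_sym M) (@accepting_sym M) C d).
split=> [|w]; first exact: reduction_polytime.
have m0 : 0 < slots w by rewrite muln_gt0 expn_gt0.
rewrite /reduction_word -/(slots w) -/(q w).
rewrite -encode_reduction_instance; last exact: query_in_range.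
have [sp hL] := hM w.
have spm t : space (run M t w) <= slots w.
  apply: leq_trans (sp t) (leq_trans (hS _) _).
  have h1 : size w ^ d <= (size w).+1 ^ d by case: (d) => // e; rewrite leq_exp2r.
  have h2 : 0 < (size w).+1 ^ d by rewrite expn_gt0.
  by rewrite /slots /slots_for /C; nia.
have main : L w <-> sem (g := g) (m := slots w) set0 (q w).
  rewrite sem_query //; last by move=> *; rewrite size_onehot.
    exact: simulation_accepts.
  exact: size_sim_rule.
rewrite main; split=> [h|[I [e _ h]]].
  exists (reduction_instance g (slots w) (q w)); split=> //.
    exact: reduction_instance_wf.
  exact/reduction_instance_sat.
(* Membership provides some instance with the printed code; injectivity of the encoding identifies
   it with the one constructed. *)
by move: h; rewrite (encode_inj e) => /reduction_instance_sat.
Qed.
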